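(* The variety of complex $3$-dimensional $(-1,1)$-superalgebras of type $(2,1)$ has dimension $5$ and has exactly $13$ irreducible components, namely $\overline{\mathcal{O}(\mathbf{R}_{k})}$ for $k\in\{01,03,04,05,07,23,25,26,29,31,32,33,36\}$. In particular, exactly $13$ superalgebras are rigid in this variety.
   Context: All algebras are over $\mathbb{C}$. A superalgebra is a $\mathbb{Z}_2$-graded algebra $A=A_0\oplus A_1$ with $A_iA_j\subseteq A_{i+j \bmod 2}$; $|x|\in\{0,1\}$ is the degree of a homogeneous $x$. It has type $(n,m)$ if $\dim A_0=n$, $\dim A_1=m$. The associator is $(x,y,z)=(xy)z-x(yz)$. A superalgebra is right alternative if $(x,y,z)=-(-1)^{|y||z|}(x,z,y)$ for all homogeneous $x,y,z$. A $(-1,1)$-superalgebra is a right alternative superalgebra satisfying $(x,y,z)+(-1)^{|x||y|+|x||z|}(y,z,x)+(-1)^{|z||y|+|x||z|}(z,x,y)=0$ for all homogeneous $x,y,z$. Geometric setting: fix a graded space $V=V_0\oplus V_1$ of type $(n,m)$ with a homogeneous basis. Superalgebra structures on $V$ are even bilinear maps $\mu:V\times V\to V$, identified with their structure constants; those satisfying a given family of graded polynomial identities form a Zariski-closed subset (an affine variety) of this affine space. The group $GL(V_0)\times GL(V_1)$ acts by $(g*\mu)(x,y)=g\mu(g^{-1}x,g^{-1}y)$; its orbits are the isomorphism classes. $\mathcal{O}(A)$ denotes the orbit of (a structure representing) $A$ and $\overline{\mathcal{O}(A)}$ its Zariski closure. A superalgebra is rigid if its orbit is open in the variety. The dimension of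 the variety is the maximal dimension of its irreducible components. Superalgebras of type $(2,1)$, in basis $e_1,e_2$ (even), $f_1$ (odd), listed by nonzero products (unlisted products are zero): $\mathbf{R}_{01}$: $e_1e_1=e_1,\ e_2e_2=e_2$; $\mathbf{R}_{03}$: $e_1e_1=e_1,\ e_2e_2=e_2,\ e_1f_1=f_1,\ f_1e_1=f_1,\ f_1f_1=e_1$; $\mathbf{R}_{04}$: $e_1e_1=e_1,\ e_2e_2=e_2,\ f_1e_1=f_1$; $\mathbf{R}_{05}$: $e_1e_1=e_1,\ e_2e_2=e_2,\ e_1f_1=f_1$; $\mathbf{R}_{07}$: $e_1e_1=e_1,\ e_2e_2=e_2,\ e_2f_1=f_1,\ f_1e_1=f_1$; $\mathbf{R}_{23}$: $e_1e_1=e_1,\ e_1e_2=e_2$; $\mathbf{R}_{25}$: $e_1e_1=e_1,\ e_2e_1=e_2$; $\mathbf{R}_{26}$: $e_1e_1=e_1,\ e_2e_1=e_2,\ e_1f_1=f_1$; $\mathbf{R}_{29}$: $e_1e_1=e_1,\ e_1e_2=e_2,\ f_1e_1=f_1$; $\mathbf{R}_{31}$: $e_1e_1=e_1,\ e_2e_1=e_2,\ f_1e_1=f_1$; $\mathbf{R}_{32}$: $e_1e_1=e_1,\ e_1e_2=e_2,\ e_1f_1=f_1$; $\mathbf{R}_{33}$: $e_1e_1=e_1,\ e_2e_1=e_2,\ e_1f_1=f_1,\ f_1e_1=f_1$; $\mathbf{R}_{36}$: $e_1e_1=e_1,\ e_1e_2=e_2,\ e_1f_1=f_1,\ f_1e_1=f_1$.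 *)

(* Defs.v *)
From mathcomp Require Import all_boot all_algebra.
From mathcomp Require Import Rstruct.
From mathcomp.real_closed Require Export complex.
From Stdlib Require Export Reals.

Set Implicit Arguments.
Unset Strict Implicit.
Unset Printing Implicit Defensive.
Import GRing.Theory.
Local Open Scope ring_scope.

Definition CC : fieldType := complex Rdefinitions.R.

Section SuperVariety.
Variable C : fieldType.

(* Graded space V = V_0 (+) V_1 of type (2,1), basis e1 = 0, e2 = 1 (even),
   f1 = 2 (odd).  deg i = true means odd. *)
Definition deg (i : 'I_3) : bool := i == 2 :> nat.

(* A bilinear map mu : V x V -> V, given by its structure constants:
   mu(b_i, b_j) = sum_k (str_const i j k) b_k. *)
Definition str := 'I_3 -> 'I_3 -> 'I_3 -> C.
Definition vec := 'I_3 -> C.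

Definition even_str (mu : str) : Prop :=
  forall i j k, (deg i (+) deg j) != deg k -> mu i j k = 0.

Definition mulv (mu : str) (x y : vec) : vec :=
  fun k => \sum_(i < 3) \sum_(j < 3) x i * y j * mu i j k.

Definition assoc (mu : str) (x y z : vec) : vec :=
  fun k => mulv mu (mulv mu x y) z k - mulv mu x (mulv mu y z) k.

Definition homog (a : bool) (x : vec) : Prop := forall i, deg i != a -> x i = 0.

Definition sgn (b : bool) : C := if b then -1 else 1.

Definition right_alternative (mu : str) : Prop :=
  forall (a b c : bool) (x y z : vec), homog a x -> homog b y -> homog c z ->
  forall k, assoc mu x y z k = - (sgn (b && c) * assoc mu x z y k).

Definition m11_identity (mu : str) : Prop :=
  forall (a b c : bool) (x y z : vec), homog a x -> homog b y -> homog c z ->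
  forall k, assoc mu x y z k
            + sgn ((a && b) (+) (a && c)) * assoc mu y z x k
            + sgn ((c && b) (+) (a && c)) * assoc mu z x y k = 0.

Definition m11_variety (mu : str) : Prop :=
  even_str mu /\ right_alternative mu /\ m11_identity mu.

Inductive pexpr : Type :=
| PConst of C
| PVar of 'I_3 & 'I_3 & 'I_3
| PAdd of pexpr & pexpr
| PMul of pexpr & pexpr.

Fixpoint peval (mu : str) (p : pexpr) : C :=
  match p with
  | PConst c => c
  | PVar i j k => mu i j k
  | PAdd p q => peval mu p + peval mu q
  | PMul p q => peval mu p * peval mu q
  end.

Definition sset := str -> Prop.

Definition subs (A B : sset) : Prop := forall mu, A mu -> B mu.
Definition seqs (A B : sset) : Prop := forall mu, A mu <-> B mu.

Definition zclosed (A : sset) : Prop :=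
  exists S : pexpr -> Prop, forall mu, A mu <-> (forall p, S p -> peval mu p = 0).

Definition zclosure (A : sset) : sset :=
  fun mu => forall p, (forall nu, A nu -> peval nu p = 0) -> peval mu p = 0.

Definition rel_closed (X Y : sset) : Prop :=
  exists Z, zclosed Z /\ forall mu, Y mu <-> (X mu /\ Z mu).

Definition rel_open (X Y : sset) : Prop :=
  exists Z, zclosed Z /\ forall mu, Y mu <-> (X mu /\ ~ Z mu).

Definition irreducible (Y : sset) : Prop :=
  (exists mu, Y mu) /\
  forall Z1 Z2, zclosed Z1 -> zclosed Z2 ->
    subs Y (fun mu => Z1 mu \/ Z2 mu) -> subs Y Z1 \/ subs Y Z2.

Definition irr_component (X Y : sset) : Prop :=
  rel_closed X Y /\ irreducible Y /\
  forall Y', rel_closed X Y' -> irreducible Y' -> subs Y Y' -> subs Y' Y.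

Definition has_chain (Z : sset) (n : nat) : Prop :=
  exists Ys : nat -> sset,
    (forall m : nat, leq m n -> rel_closed Z (Ys m) /\ irreducible (Ys m)) /\
    (forall m : nat, leq m.+1 n -> subs (Ys m) (Ys m.+1) /\ ~ subs (Ys m.+1) (Ys m)).

Definition variety_dim (X : sset) (d : nat) : Prop :=
  (exists Z, irr_component X Z /\ has_chain Z d) /\
  (forall Z, irr_component X Z -> ~ has_chain Z d.+1).

Definition app (M : 'M[C]_3) (x : vec) : vec := fun k => \sum_(j < 3) M k j * x j.
Definition bvec (i : 'I_3) : vec := fun j => (i == j)%:R.

(* GL(V_0) x GL(V_1) = invertible block-diagonal matrices *)
Definition in_group (M : 'M[C]_3) : Prop :=
  M \in unitmx /\ forall i j, deg i != deg j -> M i j = 0.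

Definition act (M : 'M[C]_3) (mu : str) : str :=
  fun i j k => app M (mulv mu (app (invmx M) (bvec i)) (app (invmx M) (bvec j))) k.

Definition sorbit (mu : str) : sset :=
  fun nu => exists M, in_group M /\ forall i j k, nu i j k = act M mu i j k.

Definition rigid (X : sset) (mu : str) : Prop := rel_open X (sorbit mu).

Definition e1 : 'I_3 := @Ordinal 3 0 isT.
Definition e2 : 'I_3 := @Ordinal 3 1 isT.
Definition f1 : 'I_3 := @Ordinal 3 2 isT.

(* structure whose listed products (x, y, z) mean x y = z; others are zero *)
Definition of_table (l : seq ('I_3 * 'I_3 * 'I_3)) : str :=
  fun i j k => ((i, j, k) \in l)%:R.

Definition R01 := of_table [:: (e1,e1,e1); (e2,e2,e2)].
Definition R03 := of_table [:: (e1,e1,e1); (e2,e2,e2); (e1,f1,f1); (f1,e1,f1); (f1,f1,e1)].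
Definition R04 := of_table [:: (e1,e1,e1); (e2,e2,e2); (f1,e1,f1)].
Definition R05 := of_table [:: (e1,e1,e1); (e2,e2,e2); (e1,f1,f1)].
Definition R07 := of_table [:: (e1,e1,e1); (e2,e2,e2); (e2,f1,f1); (f1,e1,f1)].
Definition R23 := of_table [:: (e1,e1,e1); (e1,e2,e2)].
Definition R25 := of_table [:: (e1,e1,e1); (e2,e1,e2)].
Definition R26 := of_table [:: (e1,e1,e1); (e2,e1,e2); (e1,f1,f1)].
Definition R29 := of_table [:: (e1,e1,e1); (e1,e2,e2); (f1,e1,f1)].
Definition R31 := of_table [:: (e1,e1,e1); (e2,e1,e2); (f1,e1,f1)].
Definition R32 := of_table [:: (e1,e1,e1); (e1,e2,e2); (e1,f1,f1)].
Definition R33 := of_table [:: (e1,e1,e1); (e2,e1,e2); (e1,f1,f1); (f1,e1,f1)].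
Definition R36 := of_table [:: (e1,e1,e1); (e1,e2,e2); (e1,f1,f1); (f1,e1,f1)].

Definition Rlist : seq str :=
  [:: R01; R03; R04; R05; R07; R23; R25; R26; R29; R31; R32; R33; R36].

Definition Rk (k : 'I_13) : str := nth R01 Rlist k.

End SuperVariety.

(* Main.v *)
Require Import Defs.
From mathcomp Require Import all_boot all_order all_algebra.
From mathcomp Require Import Rstruct.
From mathcomp Require Import ring.
From mathcomp Require mpoly.
From Stdlib Require Import Classical FunctionalExtensionality PropExtensionality.
Set Implicit Arguments.
Unset Strict Implicit.
Unset Printing Implicit Defensive.
Import GRing.Theory Num.Theory.
Local Open Scope ring_scope.

(* Let X be the variety. An even element x with x, x^2 independent generates A_0, which is then commutative with
   two (possibly zero or equal) characters s1, s2; the characters of the two actions on f1 lie in {0, s1, s2}, and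
   perturbing the parameters shows that such an algebra degenerates from one of R01, R03, R04, R05, R07. If every even
   element is an eigenvector of squaring, then A_0 has zero product (a degeneration of R03) or xy = l(x)y or xy = l(y)x,
   which gives exactly the other eight orbits. So X is the union of the 13 orbit closures.

   Each of the 13 orbits is open in X: some polynomial F, nonzero at a point of the orbit, has all its nonzeros in X
   inside the orbit. Orbit closures are irreducible because two points of an orbit lie on a rational curve in it. Open
   orbits that are pairwise disjoint cannot lie in each other's closures, so the closures are the components and the
   rigid algebras are the R_k.

   If Y_0 < ... < Y_n is a chain of irreducible closed sets and f_m vanishes on Y_(m-1) but not on Y_m, then the
   monomials in f_1, ..., f_n are linearly independent on Y_n. An orbit is parametrized by the 5 entries of a block
   matrix, and N^6 polynomials of degree O(N) in 5 variables are linearly dependent for large N; so n <= 5. *)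

(** * Graded linear algebra, transport of structure, and identities on basis vectors *)

Lemma ord3P (P : 'I_3 -> Prop) : P e1 -> P e2 -> P f1 -> forall i, P i.
Proof.
move=> P0 P1 P2 [[|[|[|m]]] Hi] //; [move: P0 | move: P1 | move: P2];
  by rewrite /e1 /e2 /f1; congr P; apply: val_inj.
Qed.

Lemma sum3 (V : nmodType) (F : 'I_3 -> V) : \sum_(i < 3) F i = F e1 + F e2 + F f1.
Proof.
rewrite !big_ord_recl big_ord0 addr0 addrA.
by congr (F _ + F _ + F _); apply: val_inj.
Qed.

Lemma funext3 (T : Type) (f g : 'I_3 -> 'I_3 -> 'I_3 -> T) :
  (forall i j k, f i j k = g i j k) -> f = g.
Proof.
move=> fg; apply: functional_extensionality => i; apply: functional_extensionality => j.
exact: functional_extensionality.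
Qed.

Section Action.
Variable C : fieldType.
Implicit Types (mu nu : str C) (M N : 'M[C]_3) (x y z : vec C).

Lemma app_mul M N x : app (M *m N) x = app M (app N x).
Proof.
apply: functional_extensionality => k; rewrite /app.
under eq_bigr => j _ do rewrite mxE big_distrl.
rewrite exchange_big; apply: eq_bigr => j _ /=.
by rewrite big_distrr; apply: eq_bigr => l _ /=; rewrite mulrA.
Qed.

Lemma app_1 x : app 1%:M x = x.
Proof.
apply: functional_extensionality => k; rewrite /app (bigD1 k) //= big1 ?addr0 => [|j nj].
  by rewrite mxE eqxx mul1r.
by rewrite mxE eq_sym (negbTE nj) mul0r.
Qed.

Lemma app_invK M x : M \in unitmx -> app M (app (invmx M) x) = x.
Proof. by move=> uM; rewrite -app_mul mulmxV // app_1. Qed.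

Lemma app_Kinv M x : M \in unitmx -> app (invmx M) (app M x) = x.
Proof. by move=> uM; rewrite -app_mul mulVmx // app_1. Qed.

Lemma app_bvec M i k : app M (bvec C i) k = M k i.
Proof.
rewrite /app (bigD1 i) //= big1 ?addr0 => [|j nj]; rewrite /bvec ?eqxx ?mulr1 //.
by rewrite eq_sym (negbTE nj) mulr0.
Qed.

Lemma mulv_bvec mu i j k : mulv mu (bvec C i) (bvec C j) k = mu i j k.
Proof.
rewrite /mulv (bigD1 i) //= [X in _ + X]big1 ?addr0 => [|i' ni]; last first.
  by apply: big1 => j' _; rewrite /bvec eq_sym (negbTE ni) !mul0r.
rewrite (bigD1 j) //= big1 ?addr0 => [|j' nj]; rewrite /bvec ?eqxx ?mul1r //.
by rewrite eq_sym (negbTE nj) mul0r.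
Qed.

Lemma app_sum M (I : finType) (F : I -> vec C) (c : I -> C) k :
  app M (fun l => \sum_i c i * F i l) k = \sum_i c i * app M (F i) k.
Proof.
rewrite /app; under eq_bigr => j _ do rewrite big_distrr.
rewrite exchange_big; apply: eq_bigr => i _ /=.
by rewrite big_distrr; apply: eq_bigr => j _ /=; rewrite mulrCA.
Qed.

(** Division-free form of [nu = act M mu]: no inverse matrix occurs, so an isomorphism can be
    checked by identities between matrix entries and structure constants. *)
Definition intertwines M mu nu :=
  forall x y, mulv nu (app M x) (app M y) = app M (mulv mu x y).

Lemma intertwines_basis M mu nu :
  (forall i j k, \sum_(l < 3) M k l * mu i j l =
     \sum_(p < 3) \sum_(q < 3) M p i * M q j * nu p q k) ->
  intertwines M mu nu.
Proof.
move=> H x y; apply: functional_extensionality => k.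
transitivity (\sum_i \sum_j x i * y j * \sum_(l < 3) M k l * mu i j l); last first.
  rewrite /app /mulv.
  under [RHS]eq_bigr => l _ do (rewrite big_distrr /=;
    under eq_bigr => i _ do rewrite big_distrr /=).
  rewrite [RHS]exchange_big /=; apply: eq_bigr => i _.
  rewrite [RHS]exchange_big /=; apply: eq_bigr => j _.
  by rewrite big_distrr; apply: eq_bigr => l _ /=; ring.
under [RHS]eq_bigr => i _ do under eq_bigr => j _ do rewrite H.
rewrite /mulv /app !sum3; ring.
Qed.

Lemma mulv_suml mu (F : 'I_3 -> vec C) (c : 'I_3 -> C) y k :
  mulv mu (fun l => \sum_(i < 3) c i * F i l) y k = \sum_(i < 3) c i * mulv mu (F i) y k.
Proof. rewrite /mulv !sum3; ring. Qed.

Lemma mulv_sumr mu (F : 'I_3 -> vec C) (c : 'I_3 -> C) x k :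
  mulv mu x (fun l => \sum_(i < 3) c i * F i l) k = \sum_(i < 3) c i * mulv mu x (F i) k.
Proof. rewrite /mulv !sum3; ring. Qed.

Lemma app_columns M x : app M x = fun l => \sum_(i < 3) x i * app M (bvec C i) l.
Proof.
apply: functional_extensionality => l; rewrite [LHS]/app.
by apply: eq_bigr => i _; rewrite app_bvec mulrC.
Qed.

Lemma intertwines_act M mu : M \in unitmx -> intertwines M mu (act M mu).
Proof.
move=> uM x y; apply: functional_extensionality => k.
rewrite -[in RHS](app_Kinv x uM) -[in RHS](app_Kinv y uM).
set x' := app M x; set y' := app M y.
transitivity (\sum_(i < 3) x' i * (\sum_(j < 3) y' j *
   app M (mulv mu (app (invmx M) (bvec C i)) (app (invmx M) (bvec C j))) k)).
  rewrite /mulv; apply: eq_bigr => i _; rewrite big_distrr /=; apply: eq_bigr => j _.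
  by rewrite mulrA.
have -> : mulv mu (app (invmx M) x') (app (invmx M) y') =
    fun l => \sum_(i < 3) x' i * (\sum_(j < 3) y' j *
      mulv mu (app (invmx M) (bvec C i)) (app (invmx M) (bvec C j)) l).
  apply: functional_extensionality => l.
  rewrite (app_columns _ x') (app_columns _ y') mulv_suml; apply: eq_bigr => i _.
  by rewrite mulv_sumr.
rewrite (app_sum M (fun i l => \sum_(j < 3) y' j * mulv mu (app (invmx M) (bvec C i))
   (app (invmx M) (bvec C j)) l)); apply: eq_bigr => i _.
by rewrite (app_sum M (fun j l => mulv mu (app (invmx M) (bvec C i))
   (app (invmx M) (bvec C j)) l)).
Qed.

Lemma intertwines_unique M mu nu : M \in unitmx -> intertwines M mu nu -> nu = act M mu.
Proof.
move=> uM H; apply: funext3 => i j k; rewrite /act -H.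
by rewrite !app_invK // mulv_bvec.
Qed.

Lemma sorbitE mu nu : sorbit mu nu <-> exists M, in_group M /\ intertwines M mu nu.
Proof.
split=> [[M [GM H]]|[M [GM H]]]; exists M; split=> //.
  have -> : nu = act M mu by apply: funext3.
  by apply: intertwines_act; case: GM.
by rewrite (intertwines_unique _ H) //; case: GM.
Qed.

Lemma in_group1 : in_group (1%:M : 'M[C]_3).
Proof.
split=> [|i j]; first exact: unitmx1.
by rewrite mxE; case: (eqVneq i j) => [->|_]; rewrite ?eqxx.
Qed.

Lemma in_groupM M N : in_group M -> in_group N -> in_group (M *m N).
Proof.
move=> [uM hM] [uN hN]; split=> [|i j dij]; first by rewrite unitmx_mul uM.
rewrite mxE big1 // => k _.
case: (eqVneq (deg i) (deg k)) => [dik|/hM ->]; last by rewrite mul0r.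
by rewrite hN ?mulr0 // -dik.
Qed.

(* A matrix is block diagonal iff it commutes with the degree matrix, a condition that passes to inverses. *)
Lemma in_groupV M : in_group M -> in_group (invmx M).
Proof.
move=> [uM hM]; split=> [|i j dij]; first by rewrite unitmx_inv.
pose D : 'M[C]_3 := diag_mx (\row_i (deg i)%:R).
have comMD : M *m D = D *m M.
  apply/matrixP => k l; rewrite mul_mx_diag mul_diag_mx !mxE mulrC.
  by case: (eqVneq (deg k) (deg l)) => [->//|/hM ->]; rewrite !mulr0.
have : invmx M *m D = D *m invmx M.
  by rewrite -[LHS]mulmx1 -(mulmxV uM) !mulmxA -[_ *m D *m M]mulmxA -comMD !mulmxA mulVmx // mul1mx.
move=> /matrixP /(_ i j); rewrite mul_mx_diag mul_diag_mx !mxE mulrC.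
by move: dij; case: (deg i); case: (deg j) => //= _; rewrite !(mul0r, mul1r).
Qed.

Lemma homog_app M a x : in_group M -> homog a x -> homog a (app M x).
Proof.
move=> [_ hM] hx i di; rewrite /app big1 // => j _.
case: (eqVneq (deg j) a) => [dj|/hx ->]; last by rewrite mulr0.
by rewrite hM ?mul0r // dj.
Qed.

Lemma sorbit_refl mu : sorbit mu mu.
Proof.
apply/sorbitE; exists 1%:M; split; first exact: in_group1.
by move=> x y; rewrite !app_1.
Qed.

Lemma sorbit_sym mu nu : sorbit mu nu -> sorbit nu mu.
Proof.
move=> /sorbitE [M [GM H]]; apply/sorbitE; exists (invmx M); split; first exact: in_groupV.
have uM : M \in unitmx by case: GM.
by move=> x y; rewrite -(app_Kinv (mulv mu _ _) uM) -H !app_invK.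
Qed.

Lemma sorbit_trans mu nu rho : sorbit mu nu -> sorbit nu rho -> sorbit mu rho.
Proof.
move=> /sorbitE [M [GM H]] /sorbitE [N [GN K]]; apply/sorbitE; exists (N *m M).
split; first exact: in_groupM.
by move=> x y; rewrite !app_mul K H.
Qed.

Lemma sorbit_act M mu : in_group M -> sorbit mu (act M mu).
Proof. by move=> GM; exists M. Qed.

Lemma assoc_app M mu nu x y z : intertwines M mu nu ->
  assoc nu (app M x) (app M y) (app M z) = app M (assoc mu x y z).
Proof.
move=> H; apply: functional_extensionality => k; rewrite /assoc !H.
rewrite /app -sumrB; apply: eq_bigr => j _; ring.
Qed.

Definition assocb mu (i j l k : 'I_3) : C :=
  \sum_(m < 3) mu i j m * mu m l k - \sum_(m < 3) mu j l m * mu i m k.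

Lemma assocE mu x y z k :
  assoc mu x y z k = \sum_(i < 3) \sum_(j < 3) \sum_(l < 3) x i * y j * z l * assocb mu i j l k.
Proof. rewrite /assoc /mulv /assocb !sum3; ring. Qed.

Lemma assoc_bvec mu i j l k :
  assoc mu (bvec C i) (bvec C j) (bvec C l) k = assocb mu i j l k.
Proof.
have E a b : mulv mu (bvec C a) (bvec C b) = mu a b.
  by apply: functional_extensionality => m; rewrite mulv_bvec.
rewrite /assoc /assocb !E; congr (_ - _).
  by move: l; apply: ord3P; rewrite /mulv /bvec !sum3 /=; ring.
by move: i; apply: ord3P; rewrite /mulv /bvec !sum3 /=; ring.
Qed.

Lemma homog_bvec i : homog (deg i) (bvec C i).
Proof. by move=> j; rewrite /bvec; case: (eqVneq i j) => [->|]; rewrite ?eqxx. Qed.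

Definition m11_eqs mu :=
  [/\ even_str mu,
      forall i j l k, assocb mu i j l k = - (sgn C (deg j && deg l) * assocb mu i l j k) &
      forall i j l k, assocb mu i j l k
        + sgn C ((deg i && deg j) (+) (deg i && deg l)) * assocb mu j l i k
        + sgn C ((deg l && deg j) (+) (deg i && deg l)) * assocb mu l i j k = 0].

(** A coefficient [x i * y j * z l] vanishes unless the degrees of the indices are those of the
    vectors. Hence the sign of a homogeneous identity may be replaced, term by term, by the sign
    attached to the basis vectors. *)
Lemma homog_term a b c x y z i j l (A B : C) :
  homog a x -> homog b y -> homog c z ->
  (deg i = a -> deg j = b -> deg l = c -> A = B) ->
  x i * y j * z l * A = x i * y j * z l * B.
Proof.
move=> hx hy hz H.
case: (eqVneq (deg i) a) => [Ei|/hx ->]; last by rewrite !mul0r.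
case: (eqVneq (deg j) b) => [Ej|/hy ->]; last by rewrite mulr0 !mul0r.
case: (eqVneq (deg l) c) => [El|/hz ->]; last by rewrite mulr0 !mul0r.
by rewrite H.
Qed.

(** The associator is trilinear, so both identities reduce to basis vectors, that is, to finitely
    many polynomial equations in the structure constants. *)
Lemma m11_varietyP mu : m11_variety mu <-> m11_eqs mu.
Proof.
split=> [[ev [ra mi]]|[ev ra mi]].
  split=> // i j l k; rewrite -!assoc_bvec.
    by apply: ra; apply: homog_bvec.
  by apply: mi; apply: homog_bvec.
split=> //; split=> a b c x y z hx hy hz k.
  transitivity (\sum_(i < 3) \sum_(j < 3) \sum_(l < 3) x i * y j * z l *
     (- (sgn C (b && c) * assocb mu i l j k))).
    rewrite assocE; apply: eq_bigr => i _; apply: eq_bigr => j _; apply: eq_bigr => l _.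
    by apply: homog_term hx hy hz _ => _ <- <-.
  rewrite assocE !sum3; ring.
transitivity (\sum_(i < 3) \sum_(j < 3) \sum_(l < 3) x i * y j * z l *
     (assocb mu i j l k + sgn C ((a && b) (+) (a && c)) * assocb mu j l i k
      + sgn C ((c && b) (+) (a && c)) * assocb mu l i j k)).
  by rewrite !assocE !sum3; ring.
apply: big1 => i _; apply: big1 => j _; apply: big1 => l _.
rewrite -[RHS](mulr0 (x i * y j * z l)).
by apply: homog_term hx hy hz _ => <- <- <-.
Qed.

Lemma m11_sorbit mu nu : sorbit mu nu -> m11_variety mu -> m11_variety nu.
Proof.
move=> /sorbitE [M [GM H]] [ev [ra mi]].
have uM : M \in unitmx by case: GM.
have GV := in_groupV GM.
have E x y z : assoc nu x y z = app M (assoc mu (app (invmx M) x) (app (invmx M) y) (app (invmx M) z)).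
  by rewrite -(assoc_app _ _ _ H) !app_invK.
split; [|split].
- move=> i j k dijk; rewrite -mulv_bvec -(app_invK (bvec C i) uM) -(app_invK (bvec C j) uM) H.
  have : homog (deg i (+) deg j) (app M (mulv mu (app (invmx M) (bvec C i)) (app (invmx M) (bvec C j)))).
    apply: homog_app => // l dl; rewrite /mulv.
    have hi := homog_app GV (@homog_bvec i); have hj := homog_app GV (@homog_bvec j).
    apply: big1 => p _; apply: big1 => q _.
    case: (eqVneq (deg p) (deg i)) => [dp|/hi ->]; last by rewrite !mul0r.
    case: (eqVneq (deg q) (deg j)) => [dq|/hj ->]; last by rewrite mulr0 mul0r.
    by rewrite ev ?mulr0 // dp dq eq_sym.
  by apply; rewrite eq_sym.
- move=> a b c x y z hx hy hz k; rewrite !E.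
  have R := ra a b c _ _ _ (homog_app GV hx) (homog_app GV hy) (homog_app GV hz).
  by rewrite /app big_distrr -sumrN; apply: eq_bigr => j _ /=; rewrite R mulrN mulrCA.
move=> a b c x y z hx hy hz k; rewrite !E.
have R := mi a b c _ _ _ (homog_app GV hx) (homog_app GV hy) (homog_app GV hz).
rewrite {1 2 3}/app !big_distrr -!big_split; apply: big1 => j _ /=.
by rewrite !(mulrCA _ (M k j)) -!mulrDr R mulr0.
Qed.

End Action.

(** * Zariski-closed sets and rational curves *)

Section Polynomials.
Variable C : fieldType.
Implicit Types (mu nu : str C) (A B : sset C) (M : 'M[C]_3).

(** Extensional counterpart of [pexpr]: functions are shown to be polynomial through closure
    properties, without writing syntax trees. *)
Definition polynomial (F : str C -> C) := exists p, forall mu, peval mu p = F mu.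

Lemma polynomial_const c : polynomial (fun=> c).
Proof. by exists (PConst c). Qed.

Lemma polynomial_coord i j k : polynomial (fun mu => mu i j k).
Proof. by exists (PVar _ i j k). Qed.

Lemma polynomialD F G : polynomial F -> polynomial G -> polynomial (fun mu => F mu + G mu).
Proof. by move=> [p hp] [q hq]; exists (PAdd p q) => mu /=; rewrite hp hq. Qed.

Lemma polynomialM F G : polynomial F -> polynomial G -> polynomial (fun mu => F mu * G mu).
Proof. by move=> [p hp] [q hq]; exists (PMul p q) => mu /=; rewrite hp hq. Qed.

Lemma polynomialN F : polynomial F -> polynomial (fun mu => - F mu).
Proof. by move=> [p hp]; exists (PMul (PConst (-1)) p) => mu /=; rewrite hp mulN1r. Qed.

Lemma polynomialB F G : polynomial F -> polynomial G -> polynomial (fun mu => F mu - G mu).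
Proof. by move=> hF hG; apply: polynomialD => //; apply: polynomialN. Qed.

Lemma polynomialX n F : polynomial F -> polynomial (fun mu => F mu ^+ n).
Proof.
move=> hF; elim: n => [|n [p hp]]; first exact: polynomial_const.
by case: hF => q hq; exists (PMul q p) => mu /=; rewrite hp hq exprS.
Qed.

Lemma polynomial_sum n (F : 'I_n -> str C -> C) :
  (forall i, polynomial (F i)) -> polynomial (fun mu => \sum_(i < n) F i mu).
Proof.
elim: n F => [|n IH] F hF.
  by exists (PConst 0) => mu; rewrite big_ord0.
have [p hp] := IH (fun i => F (lift ord0 i)) (fun i => hF _); have [q hq] := hF ord0.
by exists (PAdd q p) => mu; rewrite big_ord_recl /= hp hq.
Qed.

Lemma polynomial_comp (h : str C -> str C) F :
  (forall i j k, polynomial (fun mu => h mu i j k)) -> polynomial F ->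
  polynomial (fun mu => F (h mu)).
Proof.
move=> hh [p hp]; suff [q hq] : polynomial (fun mu => peval (h mu) p).
  by exists q => mu; rewrite hq hp.
elim: p {hp F} => [c|i j k|p IHp q IHq|p IHp q IHq] /=.
- exact: polynomial_const.
- exact: hh.
- exact: polynomialD.
- exact: polynomialM.
Qed.

Lemma polynomial_act M F : polynomial F -> polynomial (fun mu => F (act M mu)).
Proof.
apply: polynomial_comp => i j k; rewrite /act /app /mulv.
apply: polynomial_sum => l; apply: polynomialM; first exact: polynomial_const.
apply: polynomial_sum => p; apply: polynomial_sum => q.
by apply: polynomialM; [apply: polynomial_const | apply: polynomial_coord].
Qed.

(** The index type may be infinite; [orbit_open] takes the whole group as index type. *)
Lemma zclosed_zeros (I : Type) (F : I -> str C -> C) :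
  (forall i, polynomial (F i)) -> zclosed (fun mu => forall i, F i mu = 0).
Proof.
move=> hF; exists (fun p => exists i, forall mu, peval mu p = F i mu) => mu.
split=> [H p [i ->] //|H i].
by have [p hp] := hF i; rewrite -hp; apply: H; exists i.
Qed.

Lemma zclosed_and A B : zclosed A -> zclosed B -> zclosed (fun mu => A mu /\ B mu).
Proof.
move=> [S hS] [T hT]; exists (fun p => S p \/ T p) => mu; split.
  by move=> [/hS hA /hT hB] p [/hA|/hB].
by move=> H; split; [apply/hS | apply/hT] => p hp; apply: H; [left | right].
Qed.

Lemma zclosed_or A B : zclosed A -> zclosed B -> zclosed (fun mu => A mu \/ B mu).
Proof.
move=> [S hS] [T hT].
exists (fun r => exists p q, [/\ S p, T q & r = PMul p q]) => mu; split.
  by move=> [/hS H|/hT H] _ [p [q [Sp Tq ->]]] /=; [rewrite (H p) ?mul0r | rewrite (H q) ?mulr0].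
move=> H; apply: NNPP => /not_or_and [nA nB].
have [p [Sp np]] : exists p, S p /\ peval mu p <> 0.
  apply: NNPP => np; apply: nA; apply/hS => p Sp; apply: NNPP => pp; apply: np; by exists p.
have [q [Tq nq]] : exists q, T q /\ peval mu q <> 0.
  apply: NNPP => nq; apply: nB; apply/hT => q Tq; apply: NNPP => pp; apply: nq; by exists q.
have /= /eqP := H (PMul p q) (ex_intro _ p (ex_intro _ q (And3 Sp Tq erefl))).
by rewrite mulf_eq0 => /orP [/eqP|/eqP].
Qed.

Lemma zclosed_m11 : zclosed (@m11_variety C).
Proof.
have pa i j l k : polynomial (fun mu : str C => assocb mu i j l k).
  by apply: polynomialB; apply: polynomial_sum => m; apply: polynomialM; apply: polynomial_coord.
pose F1 (t : 'I_3 * 'I_3 * 'I_3) mu :=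
  let: (i, j, k) := t in if deg i (+) deg j != deg k then mu i j k else 0.
pose F2 (t : 'I_3 * 'I_3 * 'I_3 * 'I_3) mu := let: (i, j, l, k) := t in
  assocb mu i j l k + sgn C (deg j && deg l) * assocb mu i l j k.
pose F3 (t : 'I_3 * 'I_3 * 'I_3 * 'I_3) mu := let: (i, j, l, k) := t in
  assocb mu i j l k + sgn C ((deg i && deg j) (+) (deg i && deg l)) * assocb mu j l i k
    + sgn C ((deg l && deg j) (+) (deg i && deg l)) * assocb mu l i j k.
have h1 t : polynomial (F1 t).
  case: t => [[i j] k]; rewrite /F1; case: (deg i (+) deg j != deg k); last exact: polynomial_const.
  exact: polynomial_coord.
have h2 t : polynomial (F2 t).
  case: t => [[[i j] l] k]; apply: polynomialD => //; apply: polynomialM => //.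
  exact: polynomial_const.
have h3 t : polynomial (F3 t).
  case: t => [[[i j] l] k]; rewrite /F3; apply: polynomialD; first apply: polynomialD => //;
    by apply: polynomialM => //; apply: polynomial_const.
have [S hS] := zclosed_and (zclosed_zeros h1) (zclosed_and (zclosed_zeros h2) (zclosed_zeros h3)).
exists S => mu; rewrite -hS m11_varietyP; split.
  move=> [ev ra mi]; split; [|split].
  - by move=> [[i j] k] /=; case: ifP => // /ev.
  - by move=> [[[i j] l] k] /=; rewrite ra addNr.
  - by move=> [[[i j] l] k] /=; exact: mi.
move=> [ev [ra mi]]; split.
- by move=> i j k dk; have /= := ev (i, j, k); rewrite dk.
- by move=> i j l k; apply/eqP; rewrite -addr_eq0; apply/eqP; exact: (ra (i, j, l, k)).
- by move=> i j l k; exact: (mi (i, j, l, k)).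
Qed.

Lemma zclosure_sub A : subs A (zclosure A).
Proof. by move=> mu Amu p; apply. Qed.

Lemma zclosure_min A Z : zclosed Z -> subs A Z -> subs (zclosure A) Z.
Proof.
by move=> [S hS] AZ mu cmu; apply/hS => p Sp; apply: cmu => nu /AZ /hS; apply.
Qed.

Lemma zclosed_zclosure A : zclosed (zclosure A).
Proof.
exists (fun p => forall nu, A nu -> peval nu p = 0) => mu; split=> [H p|H p]; exact: H.
Qed.

Lemma zclosure_mono A B : subs A (zclosure B) -> subs (zclosure A) (zclosure B).
Proof. by move=> AB; apply: zclosure_min AB; apply: zclosed_zclosure. Qed.

(** The group acts by polynomial maps that preserve each orbit, so a polynomial vanishing on the
    orbit can be pulled back along [act M]. *)
Lemma zclosure_orbit R mu nu :
  sorbit mu nu -> zclosure (sorbit R) mu -> zclosure (sorbit R) nu.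
Proof.
move=> [M [GM H]] cmu p hp; have -> : nu = act M mu by apply: funext3.
have [q hq] : polynomial (fun mu => peval (act M mu) p) by apply: (@polynomial_act M (fun mu => peval mu p)); exists p.
rewrite -hq; apply: cmu => rho Rrho; rewrite hq; apply: hp.
exact: sorbit_trans Rrho (sorbit_act _ GM).
Qed.

(* The complement of an orbit is the set where F vanishes along the whole orbit of mu, once F <> 0 cuts out a
   part of the given orbit inside X. *)
Lemma orbit_open (X : sset C) R nu0 F :
  (forall mu nu, sorbit mu nu -> X mu -> X nu) -> X R ->
  polynomial F -> sorbit R nu0 -> F nu0 <> 0 ->
  (forall mu, X mu -> F mu <> 0 -> sorbit R mu) -> rigid X R.
Proof.
move=> GX XR pF R0 nF0 HF.
pose I := {M : 'M[C]_3 | in_group M}.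
exists (fun mu => forall M : I, F (act (sval M) mu) = 0); split.
  by apply: zclosed_zeros => M; apply: polynomial_act.
move=> mu; split=> [Rmu|[Xmu nZ]].
  split; first exact: GX Rmu XR.
  have [M [GM HM]] := sorbit_trans (sorbit_sym Rmu) R0.
  by move=> /(_ (exist _ M GM)) /=; rewrite -(_ : nu0 = act M mu) //; apply: funext3.
have [M [GM HM]] : exists M, in_group M /\ F (act M mu) <> 0.
  apply: NNPP => nM; apply: nZ => -[M GM] /=; apply: NNPP => HM; apply: nM; by exists M.
have XM := GX _ _ (sorbit_act mu GM) Xmu.
exact: sorbit_trans (HF _ XM HM) (sorbit_sym (sorbit_act mu GM)).
Qed.

(** Clearing denominators: if the coordinates are fractions with common denominator [d], then a
    power of [d] times the value of [p] comes from an element [P] of [S]. Both [e] and [P] are fixed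
    before the evaluation [phi] is chosen. *)
Lemma peval_lift (S : comNzRingType) (cst : C -> S) (d : S) (Nu : 'I_3 -> 'I_3 -> 'I_3 -> S)
    (p : pexpr C) :
  exists e P, forall (phi : {rmorphism S -> C}) (nu : str C), (forall c, phi (cst c) = c) ->
    (forall i j k, phi d * nu i j k = phi (Nu i j k)) -> phi P = phi d ^+ e * peval nu p.
Proof.
elim: p => [c|i j k|p [e [P IHp]] q [f [Q IHq]]|p [e [P IHp]] q [f [Q IHq]]].
- by exists 0%N, (cst c) => phi nu -> _; rewrite mul1r.
- by exists 1%N, (Nu i j k) => phi nu _ <-; rewrite expr1.
- exists (e + f)%N, (P * d ^+ f + Q * d ^+ e) => phi nu h H.
  rewrite rmorphD !rmorphM !rmorphXn /= (IHp _ _ h H) (IHq _ _ h H) exprD; ring.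
- exists (e + f)%N, (P * Q) => phi nu h H.
  rewrite rmorphM /= (IHp _ _ h H) (IHq _ _ h H) exprD; ring.
Qed.

(** Numerator of the action: the adjugate replaces the inverse matrix, so the formula makes sense
    over polynomial rings. The inverse occurs twice, whence the factor [\det M ^+ 2] in
    [act_actnum]. *)
Definition actnum (S : comNzRingType) (M : 'M[S]_3) (mu : 'I_3 -> 'I_3 -> 'I_3 -> S) (i j k : 'I_3) : S :=
  \sum_(l < 3) M k l * \sum_(p < 3) \sum_(q < 3) \adj M p i * \adj M q j * mu p q l.

Lemma act_actnum M mu i j k : M \in unitmx ->
  \det M ^+ 2 * act M mu i j k = actnum M mu i j k.
Proof.
move=> uM; have nd : \det M != 0 by move: uM; rewrite unitmxE unitfE.
rewrite /act /actnum /app big_distrr; apply: eq_bigr => l _ /=.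
rewrite mulrCA; congr (_ * _); rewrite /mulv big_distrr; apply: eq_bigr => p _ /=.
rewrite big_distrr; apply: eq_bigr => q _ /=.
rewrite -!/(app _ _ _) !app_bvec /invmx uM !mxE.
set a := cofactor _ _ _; set b := cofactor _ _ _; by field.
Qed.

Lemma actnum_morph (S : comNzRingType) (phi : {rmorphism S -> C}) (M : 'M[S]_3)
    (mu : 'I_3 -> 'I_3 -> 'I_3 -> S) i j k :
  phi (actnum M mu i j k) = actnum (map_mx phi M) (fun i j k => phi (mu i j k)) i j k.
Proof.
rewrite /actnum rmorph_sum; apply: eq_bigr => l _ /=.
rewrite rmorphM mxE; congr (_ * _); rewrite rmorph_sum; apply: eq_bigr => p _ /=.
rewrite rmorph_sum; apply: eq_bigr => q _ /=.
by rewrite -map_mx_adj ![map_mx _ (\adj _) _ _]mxE !rmorphM.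
Qed.

End Polynomials.

Section Irreducibility.
Variable C : numClosedFieldType.
Implicit Types (mu nu : str C) (Y : sset C) (q d : {poly C}).

(** In characteristic 0 the first [size q] natural numbers are distinct, too many to be all roots of
    [q]. *)
Lemma poly_nonroot q : q != 0 -> exists x, q.[x] != 0.
Proof.
move=> nq; apply: NNPP => H.
pose s := [seq i%:R : C | i <- iota 0 (size q)].
have us : uniq s.
  by rewrite map_inj_uniq ?iota_uniq // => i j /eqP; rewrite eqr_nat => /eqP.
have rs : all (root q) s.
  by apply/allP => x _; apply/rootP; apply: NNPP => /eqP nx; apply: H; exists x.
by have := max_poly_roots nq rs us; rewrite size_map size_iota ltnn.
Qed.

Lemma poly_eq0 q : (forall x, q.[x] = 0) -> q = 0.
Proof. by move=> H; apply: NNPP => /eqP /poly_nonroot [x]; rewrite H eqxx. Qed.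

Definition curve d (Nu : 'I_3 -> 'I_3 -> 'I_3 -> {poly C}) (x : C) : str C :=
  fun i j k => (Nu i j k).[x] / d.[x].

Lemma peval_curve d Nu p : exists e (P : {poly C}), forall x, d.[x] != 0 ->
  P.[x] = d.[x] ^+ e * peval (curve d Nu x) p.
Proof.
have [e [P H]] := @peval_lift C {poly C} polyC d Nu p.
exists e, P => x nx; apply: (H (horner_eval x)) => [c|i j k]; rewrite /= /horner_eval ?hornerC //.
by rewrite /curve mulrCA divff // mulr1.
Qed.

(** Degeneration criterion: a polynomial curve that lies in [Y] outside the roots of [q] has all its
    points in the closure of [Y]. *)
Lemma zclosure_limit Y (Nu : 'I_3 -> 'I_3 -> 'I_3 -> {poly C}) q x0 : q != 0 ->
  (forall x, q.[x] != 0 -> Y (fun i j k => (Nu i j k).[x])) ->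
  zclosure Y (fun i j k => (Nu i j k).[x0]).
Proof.
move=> nq HY p hp; have [e [P hP]] := peval_curve 1 Nu p.
have E x : P.[x] = peval (fun i j k => (Nu i j k).[x]) p.
  rewrite hP hornerC ?oner_neq0 // expr1n mul1r; congr peval; apply: funext3 => i j k.
  by rewrite /curve hornerC divr1.
rewrite -E; suff -> : P = 0 by rewrite horner0.
(* Multiplying by [q] absorbs the exceptional points, where nothing is known about [P]. *)
apply/eqP; have /eqP : P * q = 0.
  apply: poly_eq0 => x; rewrite hornerM; case: (eqVneq q.[x] 0) => [->|/HY Yx].
    by rewrite mulr0.
  by rewrite E hp // mul0r.
by rewrite mulf_eq0 (negbTE nq) orbF.
Qed.

Definition rationally_connected Y := forall u v, Y u -> Y v -> exists d Nu,
  [/\ d.[0] != 0, d.[1] != 0, forall x, d.[x] != 0 -> Y (curve d Nu x),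
      curve d Nu 0 = u & curve d Nu 1 = v].

(** If neither closed set contains [Y], some [p] of the first is nonzero at [u] and some [q] of the
    second at [v]. Restricted to a curve through [u] and [v], both become nonzero polynomials in one
    variable, so a point of the curve avoids both sets. *)
Lemma irreducible_zclosure Y :
  (exists mu, Y mu) -> rationally_connected Y -> irreducible (zclosure Y).
Proof.
move=> [mu0 Y0] rc; split; first by exists mu0; apply: zclosure_sub.
move=> Z1 Z2 [S1 hS1] [S2 hS2] H; apply: NNPP => /not_or_and [n1 n2].
have sep Z S : (forall mu, Z mu <-> (forall p, S p -> peval mu p = 0)) ->
    ~ subs (zclosure Y) Z -> exists p u, [/\ S p, Y u & peval u p != 0].
  move=> hS nZ; apply: NNPP => np; apply: nZ; apply: zclosure_min; first by exists S.
  move=> u Yu; apply/hS => p Sp; apply: NNPP => /eqP nu; apply: np; by exists p, u.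
have [p [u [S1p Yu nu]]] := sep _ _ hS1 n1.
have [q [v [S2q Yv nv]]] := sep _ _ hS2 n2.
have [d [Nu [d0 d1 Yx E0 E1]]] := rc _ _ Yu Yv.
have [e [P hP]] := peval_curve d Nu p; have [f [Q hQ]] := peval_curve d Nu q.
have nP : P != 0.
  apply/eqP => P0; have /esym /eqP := hP 0 d0.
  by rewrite P0 horner0 E0 mulf_eq0 expf_eq0 (negbTE d0) andbF (negbTE nu).
have nQ : Q != 0.
  apply/eqP => Q0; have /esym /eqP := hQ 1 d1.
  by rewrite Q0 horner0 E1 mulf_eq0 expf_eq0 (negbTE d1) andbF (negbTE nv).
have nd : d != 0 by apply: contraNneq d0 => ->; rewrite horner0.
have [x] := poly_nonroot (mulf_neq0 nd (mulf_neq0 nP nQ)).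
rewrite !hornerM !mulf_eq0 !negb_or => /and3P [dx Px Qx].
case: (H (curve d Nu x)); first by apply: zclosure_sub; apply: Yx.
  by move=> /hS1 /(_ p S1p) E; move: Px; rewrite hP // E mulr0 eqxx.
by move=> /hS2 /(_ q S2q) E; move: Qx; rewrite hQ // E mulr0 eqxx.
Qed.

Lemma sorbit_rationally_connected R : rationally_connected (sorbit R).
Proof.
move=> u v [A [[uA bA] hA]] [B [[uB bB] hB]].
(* The line from [A] to [B] stays among block diagonal matrices and is invertible wherever its
   determinant does not vanish. *)
pose M : 'M[{poly C}]_3 := map_mx polyC A + 'X *: map_mx polyC (B - A).
pose Mx (x : C) := A + x *: (B - A).
have EM x : map_mx (horner_eval x) M = Mx x.
  apply/matrixP => i j; rewrite !mxE /horner_eval.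
  by rewrite hornerD hornerM !hornerC hornerX.
have dM x : (\det M).[x] = \det (Mx x).
  by rewrite -EM det_map_mx.
have EN x i j k : (actnum M (fun i j k => (R i j k)%:P) i j k).[x] = actnum (Mx x) R i j k.
  rewrite -[LHS]/(horner_eval x _) actnum_morph EM; congr actnum.
  by apply: funext3 => *; rewrite /= /horner_eval hornerC.
have M0 : Mx 0 = A by rewrite /Mx scale0r addr0.
have M1 : Mx 1 = B by rewrite /Mx scale1r addrC subrK.
have uMx x : (\det M ^+ 2).[x] != 0 -> Mx x \in unitmx.
  by rewrite horner_exp dM sqrf_eq0 unitmxE unitfE.
have cE x : Mx x \in unitmx -> curve (\det M ^+ 2) (actnum M (fun i j k => (R i j k)%:P)) x = act (Mx x) R.
  move=> ux; apply: funext3 => i j k.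
  rewrite /curve EN -act_actnum // horner_exp dM mulrC mulKf // sqrf_eq0.
  by move: ux; rewrite unitmxE unitfE.
exists (\det M ^+ 2), (actnum M (fun i j k => (R i j k)%:P)); split.
- by rewrite horner_exp dM sqrf_eq0 M0 -unitfE -unitmxE.
- by rewrite horner_exp dM sqrf_eq0 M1 -unitfE -unitmxE.
- move=> x /uMx ux; rewrite cE //; apply: sorbit_act; split=> // i j dij.
  by rewrite !mxE bA // bB // subrr mulr0 addr0.
- by rewrite cE M0 //; apply/esym/funext3.
- by rewrite cE M1 //; apply/esym/funext3.
Qed.

Lemma irreducible_orbit_closure (R : str C) : irreducible (zclosure (sorbit R)).
Proof.
apply: irreducible_zclosure; first by exists R; apply: sorbit_refl.
exact: sorbit_rationally_connected.
Qed.

End Irreducibility.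

(** * Normal forms *)

Section Tables.
Variable S : comNzRingType.

(* e1e1 = x1 e1 + x2 e2, e1e2 = p1 e1 + p2 e2, e2e1 = q1 e1 + q2 e2, e2e2 = r1 e1 + r2 e2,
   e_i f1 = a_i f1, f1 e_i = b_i f1, f1f1 = w1 e1 + w2 e2 *)
Definition table (x1 x2 p1 p2 q1 q2 r1 r2 a1 a2 b1 b2 w1 w2 : S) (i j k : 'I_3) : S :=
  match nat_of_ord i, nat_of_ord j, nat_of_ord k with
  | 0, 0, 0 => x1 | 0, 0, 1 => x2
  | 0, 1, 0 => p1 | 0, 1, 1 => p2
  | 1, 0, 0 => q1 | 1, 0, 1 => q2
  | 1, 1, 0 => r1 | 1, 1, 1 => r2
  | 0, 2, 2 => a1 | 1, 2, 2 => a2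
  | 2, 0, 2 => b1 | 2, 1, 2 => b2
  | 2, 2, 0 => w1 | 2, 2, 1 => w2
  | _, _, _ => 0
  end.

(* For t = 1 this is the algebra xS[x]/(x(x - s1)(x - s2)) in the basis x, x^2, with e1 acting on f1 by a on the
   left and by b on the right. *)
Definition fam (t s1 s2 a b c : S) :=
  table 0 t (- (t * (s1 * s2))) (t * (s1 + s2)) (- (t * (s1 * s2))) (t * (s1 + s2))
    (- (t * (s1 * s2 * (s1 + s2)))) (t * ((s1 + s2) ^+ 2 - s1 * s2))
    (t * a) (t * a ^+ 2) (t * b) (t * b ^+ 2) (- (c * s2)) c.

Definition blockmx (p q r s h : S) : 'M[S]_3 := \matrix_(i, j)
  match nat_of_ord i, nat_of_ord j with
  | 0, 0 => p | 0, 1 => q | 1, 0 => r | 1, 1 => s | 2, 2 => h | _, _ => 0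
  end.

Definition semisimple_table (a1 a2 b1 b2 w : S) := table 1 0 0 0 0 0 0 1 a1 a2 b1 b2 w 0.
(** With the linear form [l = (l1, l2)], the even product is [xy = l(x) y] here and [xy = l(y) x] in
    [right_table]; the two actions on [f1] are [a l] and [b l]. *)
Definition left_table (l1 l2 a b : S) :=
  table l1 0 0 l1 l2 0 0 l2 (a * l1) (a * l2) (b * l1) (b * l2) 0 0.
Definition right_table (l1 l2 a b : S) :=
  table l1 0 l2 0 0 l1 0 l2 (a * l1) (a * l2) (b * l1) (b * l2) 0 0.

End Tables.

Lemma table_morph (S T : comNzRingType) (phi : {rmorphism S -> T}) x1 x2 p1 p2 q1 q2 r1 r2 a1 a2 b1 b2 w1 w2 i j k :
  phi (table x1 x2 p1 p2 q1 q2 r1 r2 a1 a2 b1 b2 w1 w2 i j k) =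
  table (phi x1) (phi x2) (phi p1) (phi p2) (phi q1) (phi q2) (phi r1) (phi r2)
    (phi a1) (phi a2) (phi b1) (phi b2) (phi w1) (phi w2) i j k.
Proof.
by move: i j k; do 3![apply: ord3P]; rewrite /table /= ?rmorph0.
Qed.

Lemma fam_morph (S T : comNzRingType) (phi : {rmorphism S -> T}) t s1 s2 a b c i j k :
  phi (fam t s1 s2 a b c i j k) = fam (phi t) (phi s1) (phi s2) (phi a) (phi b) (phi c) i j k.
Proof.
by rewrite table_morph !(rmorphN, rmorph0, rmorphM, rmorphB, rmorphD, rmorphXn).
Qed.

Section NormalForms.
Variable C : numClosedFieldType.
Implicit Types (mu nu : str C).

Lemma RE :
  ([/\ R01 C = semisimple_table 0 0 0 0 0, R03 C = semisimple_table 1 0 1 0 1,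
      R04 C = semisimple_table 0 0 1 0 0, R05 C = semisimple_table 1 0 0 0 0 &
      R07 C = semisimple_table 0 1 1 0 0] *
   [/\ R23 C = left_table 1 0 0 0, R29 C = left_table 1 0 0 1,
       R32 C = left_table 1 0 1 0 & R36 C = left_table 1 0 1 1] *
   [/\ R25 C = right_table 1 0 0 0, R31 C = right_table 1 0 0 1,
       R26 C = right_table 1 0 1 0 & R33 C = right_table 1 0 1 1])%type.
Proof.
by split; [split|]; split; apply: funext3; do 3![apply: ord3P];
  rewrite /semisimple_table /left_table /right_table /table /= ?(mulr1, mulr0).
Qed.

(** The structure constants are 0 or 1, so associators are integers and the identities can be
    decided by computation, then mapped to the field. *)
Definition assocz (l : seq ('I_3 * 'I_3 * 'I_3)) (i j m k : 'I_3) : int :=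
  let T i j k : nat := (i, j, k) \in l in
  (T i j e1 * T e1 m k + T i j e2 * T e2 m k + T i j f1 * T f1 m k)%:Z -
  (T j m e1 * T i e1 k + T j m e2 * T i e2 k + T j m f1 * T i f1 k)%:Z.

Definition m11_check (l : seq ('I_3 * 'I_3 * 'I_3)) : bool :=
  let s := [:: e1; e2; f1] in
  all (fun t => ~~ (deg t.1.1 (+) deg t.1.2 != deg t.2)) l &&
  all (fun i => all (fun j => all (fun m => all (fun k =>
    (assocz l i j m k == - ((if deg j && deg m then -1 else 1) * assocz l i m j k)) &&
    (assocz l i j m k + (if (deg i && deg j) (+) (deg i && deg m) then -1 else 1) * assocz l j m i k
     + (if (deg m && deg j) (+) (deg i && deg m) then -1 else 1) * assocz l m i j k == 0)) s) s) s) s.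

Lemma m11_of_table l : m11_check l -> m11_variety (of_table C l).
Proof.
move=> /andP [/allP ev /allP ck]; apply/m11_varietyP.
have E i j m k : assocb (of_table C l) i j m k = (assocz l i j m k)%:~R.
  by rewrite /assocb /assocz !sum3 /of_table rmorphB /= -!pmulrn !natrD !natrM.
have Sg b : sgn C b = (if b then -1 else 1 : int)%:~R by case: b; rewrite /sgn ?rmorphN.
have all3 i : i \in [:: e1; e2; f1] by move: i; apply: ord3P.
have {}ck i j m k := andP (allP (allP (allP (ck i (all3 i)) j (all3 j)) m (all3 m)) k (all3 k)).
split=> [i j k d|i j m k|i j m k].
- by rewrite /of_table; case: (boolP (_ \in l)) => // /ev /=; rewrite d.
- by have [/eqP h _] := ck i j m k; rewrite !E h Sg rmorphN rmorphM.
- have [_ /eqP h] := ck i j m k.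
  by rewrite !E !Sg -!rmorphM -!rmorphD h.
Qed.

Lemma m11_Rk k : m11_variety (Rk C k).
Proof.
case: k => k; do 13?[case: k => [|k] //]; move=> ?; apply: m11_of_table; by vm_compute.
Qed.

Lemma blockmx_in_group (p q r s h : C) : p * s - q * r != 0 -> h != 0 -> in_group (blockmx p q r s h).
Proof.
move=> nd nh; split; last first.
  by do 2![apply: ord3P]; rewrite mxE.
pose d := p * s - q * r.
apply: (proj1 (mulmx1_unit (B := blockmx (s / d) (- q / d) (- r / d) (p / d) h^-1) _)).
apply/matrixP; do 2![apply: ord3P]; rewrite !mxE sum3 !mxE /=; rewrite /d; field; do ?[apply/andP; split]; done.
Qed.

(** Here [nu] is [mu] rewritten in the basis given by the columns of [M]. *)
Lemma change_basis mu (M : 'M[C]_3) : in_group M -> exists nu, sorbit mu nu /\ intertwines M nu mu.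
Proof.
move=> GM; have GV := in_groupV GM; have uM : M \in unitmx by case: GM.
exists (act (invmx M) mu); split; first exact: sorbit_act.
have H := intertwines_act mu (proj1 GV).
have uV : invmx M \in unitmx by rewrite unitmx_inv.
move=> x y; rewrite -{2}(app_Kinv x uM) -{2}(app_Kinv y uM) H app_invK //.
Qed.

Lemma intertwines_entry (M : 'M[C]_3) mu nu i j k : intertwines M mu nu ->
  \sum_(l < 3) M k l * mu i j l = \sum_(p < 3) \sum_(q < 3) M p i * M q j * nu p q k.
Proof.
move=> H.
have <- : app M (mulv mu (bvec C i) (bvec C j)) k = \sum_(l < 3) M k l * mu i j l.
  by rewrite /app; apply: eq_bigr => l _; rewrite mulv_bvec.
by rewrite -H /mulv; apply: eq_bigr => p _; apply: eq_bigr => q _; rewrite !app_bvec.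
Qed.

Lemma even_table mu : even_str mu -> mu = table (mu e1 e1 e1) (mu e1 e1 e2) (mu e1 e2 e1) (mu e1 e2 e2)
  (mu e2 e1 e1) (mu e2 e1 e2) (mu e2 e2 e1) (mu e2 e2 e2) (mu e1 f1 f1) (mu e2 f1 f1)
  (mu f1 e1 f1) (mu f1 e2 f1) (mu f1 f1 e1) (mu f1 f1 e2).
Proof.
by move=> ev; apply: funext3; do 3![apply: ord3P]; rewrite /table //=; apply: ev.
Qed.

(** For distinct nonzero [s1], [s2] the even part is a product of two fields, and the parameters of
    the table are the values of [a] and [b] under Lagrange interpolation at 0, [s1], [s2]. The
    scalar [h] rescales [f1]. *)
Lemma fam_generic t s1 s2 a b c h :
  t != 0 -> s1 != 0 -> s2 != 0 -> s1 - s2 != 0 -> h != 0 ->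
  @sorbit C (semisimple_table (a * (a - s2) / (s1 * (s1 - s2))) (a * (a - s1) / (s2 * (s2 - s1)))
     (b * (b - s2) / (s1 * (s1 - s2))) (b * (b - s1) / (s2 * (s2 - s1)))
     (h ^+ 2 * c * t * s1 * (s1 - s2)))
   (fam t s1 s2 a b c).
Proof.
move=> nt n1 n2 n12 nh.
have n21 : s2 - s1 != 0 by rewrite -opprB oppr_eq0.
have n1' : - s1 != 0 by rewrite oppr_eq0.
have n2' : - s2 != 0 by rewrite oppr_eq0.
(* The even columns are the primitive idempotents: [(e2 - s2 e1) / (s1 (s1 - s2))] and its mirror
   image, divided by [t] because every product with an even factor carries the factor [t]. *)
apply/sorbitE; exists (blockmx (- s2 / (t * s1 * (s1 - s2))) (- s1 / (t * s2 * (s2 - s1)))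
  (t * s1 * (s1 - s2))^-1 (t * s2 * (s2 - s1))^-1 h).
split.
  apply: blockmx_in_group => //.
  have -> : - s2 / (t * s1 * (s1 - s2)) / (t * s2 * (s2 - s1)) -
     - s1 / (t * s2 * (s2 - s1)) / (t * s1 * (s1 - s2)) = (t ^+ 2 * s1 * s2 * (s1 - s2) * (s2 - s1))^-1 * (s1 - s2).
    by field; rewrite nt n1 n2 n12 n21.
  by rewrite mulf_neq0 ?invr_eq0 ?mulf_neq0 ?expf_eq0.
apply: intertwines_basis; do 3![apply: ord3P];
  rewrite !sum3 !mxE /= /semisimple_table /fam /table /= ?(mul0r, mulr0, add0r, addr0); try done;
  field; by rewrite ?nt ?n1 ?n2 ?n12 ?n21.
Qed.

(** The new even basis consists of [e1 / l1], on which [l] is 1, and [l1 e2 - l2 e1], which spans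
    the kernel of [l]. The same basis serves [right_iso]. *)
Lemma left_iso l1 l2 a b : l1 != 0 -> @sorbit C (left_table 1 0 a b) (left_table l1 l2 a b).
Proof.
move=> n1; apply/sorbitE; exists (blockmx l1^-1 (- l2) 0 l1 1); split.
  by apply: blockmx_in_group; rewrite ?oner_eq0 // mulVf // mulr0 subr0 oner_eq0.
apply: intertwines_basis; do 3![apply: ord3P];
  rewrite !sum3 !mxE /= /left_table /table /= ?(mul0r, mulr0, add0r, addr0); try done; by field.
Qed.

Lemma right_iso l1 l2 a b : l1 != 0 -> @sorbit C (right_table 1 0 a b) (right_table l1 l2 a b).
Proof.
move=> n1; apply/sorbitE; exists (blockmx l1^-1 (- l2) 0 l1 1); split.
  by apply: blockmx_in_group; rewrite ?oner_eq0 // mulVf // mulr0 subr0 oner_eq0.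
apply: intertwines_basis; do 3![apply: ord3P];
  rewrite !sum3 !mxE /= /right_table /table /= ?(mul0r, mulr0, add0r, addr0); try done; by field.
Qed.

End NormalForms.

(** * Classification *)

Section Classification.
Variable C : numClosedFieldType.
Implicit Types (mu nu : str C).

(** Certificates: the goal follows once its difference is written as an explicit combination of the
    differences of the hypotheses, which [ring] or [field] then checks. *)
Lemma lincomb1 (x y c l r : C) : l = r -> x - y = c * (l - r) -> x = y.
Proof. by move=> ->; rewrite subrr mulr0 => /eqP; rewrite subr_eq0 => /eqP. Qed.

Lemma lincomb2 (x y c l r d l' r' : C) : l = r -> l' = r' ->
  x - y = c * (l - r) + d * (l' - r') -> x = y.
Proof. by move=> -> ->; rewrite !subrr !mulr0 addr0 => /eqP; rewrite subr_eq0 => /eqP. Qed.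

(* Up to exchanging s1 and s2, these are all pairs a, b in {0, s1, s2}; an odd square f1f1 <> 0 forces a = b. *)
Definition fam_type (s1 s2 a b c : C) :=
  [/\ a = 0, b = 0 & c = 0] \/ [/\ a = s1 & b = s1] \/ [/\ a = 0, b = s1 & c = 0] \/
  [/\ a = s1, b = 0 & c = 0] \/ [/\ a = s2, b = s1 & c = 0].

Ltac entry h := rewrite /assocb !sum3 /table /sgn /= in h.

(** With [e2 = e1 e1] all parameters depend on [p1], [p2], [a], [b], [c]. The numbers [s1], [s2] are
    the roots of [X^2 - p2 X - p1], and [a], [b] are roots of [X (X^2 - p2 X - p1)]. *)
Lemma power_basis_form nu : m11_variety nu -> nu e1 e1 e1 = 0 -> nu e1 e1 e2 = 1 ->
  exists s1 s2 a b c, nu = fam 1 s1 s2 a b c /\ fam_type s1 s2 a b c.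
Proof.
move=> /m11_varietyP [/even_table E ra mi] h1 h2; move: E ra mi; rewrite h1 h2.
move: (nu e1 e2 e1) (nu e1 e2 e2) (nu e2 e1 e1) (nu e2 e1 e2) (nu e2 e2 e1) (nu e2 e2 e2)
  (nu e1 f1 f1) (nu e2 f1 f1) (nu f1 e1 f1) (nu f1 e2 f1) (nu f1 f1 e1) (nu f1 f1 e2)
  => p1 p2 q1 q2 r1 r2 a a2 b b2 w1 c -> ra mi {h1 h2 nu}.
have Eq1 : q1 = p1 by have h := ra e1 e1 e1 e1; entry h; apply: (lincomb1 (c := 2^-1) h); field.
have Eq2 : q2 = p2 by have h := ra e1 e1 e1 e2; entry h; apply: (lincomb1 (c := 2^-1) h); field.
rewrite {}Eq1 {}Eq2 {q1 q2} in ra mi *.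
have Er1 : r1 = p1 * p2 by have h := ra e2 e1 e1 e1; entry h; apply: (lincomb1 (c := - 2^-1) h); field.
have Er2 : r2 = p1 + p2 * p2 by have h := ra e2 e1 e1 e2; entry h; apply: (lincomb1 (c := - 2^-1) h); field.
have Ea2 : a2 = a ^+ 2 by have h := ra e1 e1 f1 f1; entry h; apply: (lincomb1 (c := 1) h); ring.
have Ha : a * (a ^+ 2 - p2 * a - p1) = 0.
  by have h := ra e1 e2 f1 f1; entry h; rewrite Ea2 in h; apply: (lincomb1 (c := -1) h); ring.
have Eb2 : b2 = b ^+ 2 by have h := ra f1 e1 e1 f1; entry h; apply: (lincomb1 (c := - 2^-1) h); field.
have Hb : b * (b ^+ 2 - p2 * b - p1) = 0.
  by have h := ra f1 e1 e2 f1; entry h; rewrite Eb2 in h; apply: (lincomb1 (c := 2^-1) h); field.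
(* [f1 f1] is an eigenvector, with eigenvalue [a], of right multiplication by [e1]; the second
   identity forces [a = b] unless [c = 0]. *)
have W1 : p1 * c = a * w1 by have h := ra f1 e1 f1 e1; entry h; apply: (lincomb1 (c := 1) h); ring.
have W2 : w1 = (a - p2) * c by have h := ra f1 e1 f1 e2; entry h; apply: (lincomb1 (c := 1) h); ring.
have W3 : (a - b) * c = 0.
  by have h := mi e1 f1 f1 e2; entry h; apply: (lincomb1 (c := 2^-1) h); field.
move: {ra mi} Er1 Er2 Ea2 Eb2 W2 => -> -> -> -> W2; rewrite {}W2 in W1 *.
suff [s1 [s2 [E1 E2 E3 T]]] : exists s1 s2, [/\ s1 + s2 = p2, - (s1 * s2) = p1,
    (a - p2) * c = - (c * s2) & fam_type s1 s2 a b c].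
  exists s1, s2, a, b, c; split=> //; rewrite /fam -E1 -E2 E1 E3; congr table; ring.
have root x : x ^+ 2 - p2 * x - p1 = 0 ->
    [/\ x + (p2 - x) = p2, - (x * (p2 - x)) = p1 & (x - p2) * c = - (c * (p2 - x))].
  by move=> h; split; [ring | apply: (lincomb1 (c := 1) h); ring | ring].
case: (eqVneq c 0) => [c0|nc].
  have {root} root x : x ^+ 2 - p2 * x - p1 = 0 ->
      [/\ x + (p2 - x) = p2, - (x * (p2 - x)) = p1 & (a - p2) * c = - (c * (p2 - x))].
    by move=> /root [? ? _]; split=> //; rewrite c0; ring.
  move: Ha Hb => /eqP; rewrite mulf_eq0 => /orP [/eqP a0|/eqP Ha] /eqP;
    rewrite mulf_eq0 => /orP [/eqP b0|/eqP Hb].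
  (* For [a = b = 0] any root will do; the quadratic formula supplies one. *)
  - have [s Hs] : exists s, s ^+ 2 - p2 * s - p1 = 0.
      exists ((p2 + sqrtC (p2 ^+ 2 + 4 * p1)) / 2).
      have h := sqrtCK (p2 ^+ 2 + 4 * p1); apply: (lincomb1 (c := 4^-1) h).
      by set u := sqrtC _; field.
    by have [? ? ?] := root _ Hs; exists s, (p2 - s); split=> //; left.
  - have [? ? ?] := root _ Hb; exists b, (p2 - b); split=> //.
    by right; right; left.
  - have [? ? ?] := root _ Ha; exists a, (p2 - a); split=> //.
    by do 3!right; left.
  - have [? ? ?] := root _ Hb; exists b, (p2 - b); split=> //.
    case: (eqVneq a b) => [->|nab]; first by right; left.
    do 4!right; split=> //; apply/eqP; rewrite -subr_eq0; apply/eqP.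
    have nab' : a - b != 0 by rewrite subr_eq0.
    by apply: (mulfI nab'); apply: (lincomb2 (c := 1) (d := -1) Ha Hb); ring.
have Eab : a = b by move: W3 => /eqP; rewrite mulf_eq0 (negbTE nc) orbF subr_eq0 => /eqP.
have Hr : a ^+ 2 - p2 * a - p1 = 0 by apply: (mulIf nc); apply: (lincomb1 (c := -1) W1); ring.
have [? ? ?] := root _ Hr; exists a, (p2 - a); split=> //.
by right; left; rewrite -Eab.
Qed.

(** The new even basis is [e1], [e1 e1]. The second group of equalities reads the new parameters off
    the coordinates of [mu], which is what allows open conditions on them to be polynomial in
    [mu]. *)
Lemma power_basis mu : m11_variety mu -> mu e1 e1 e2 != 0 -> exists nu,
  [/\ sorbit mu nu, nu e1 e1 e1 = 0 & nu e1 e1 e2 = 1] /\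
  [/\ nu e1 e2 e2 = mu e1 e1 e1 + mu e1 e2 e2,
      nu e1 e2 e1 = mu e1 e2 e1 * mu e1 e1 e2 - mu e1 e2 e2 * mu e1 e1 e1,
      nu e1 f1 f1 = mu e1 f1 f1, nu f1 e1 f1 = mu f1 e1 f1 &
      nu f1 f1 e2 * mu e1 e1 e2 = mu f1 f1 e2].
Proof.
move=> Xmu nx.
have GM : in_group (blockmx 1 (mu e1 e1 e1) 0 (mu e1 e1 e2) 1).
  by apply: blockmx_in_group; rewrite ?oner_eq0 // mulr0 subr0 mul1r.
have [nu [Rnu H]] := change_basis mu GM; exists nu.
have /m11_varietyP [/even_table Enu _ _] := m11_sorbit Rnu Xmu.
have /m11_varietyP [/even_table Emu _ _] := Xmu.
have {H} H i j k := intertwines_entry i j k H.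
have X2 : nu e1 e1 e2 = 1.
  have h := H e1 e1 e2; rewrite !sum3 !mxE /= in h.
  by apply: (mulfI nx); apply: (lincomb1 (c := 1) h); ring.
have X1 : nu e1 e1 e1 = 0.
  have h := H e1 e1 e1; rewrite !sum3 !mxE /= X2 in h.
  by apply: (lincomb1 (c := 1) h); ring.
have P2 : nu e1 e2 e2 = mu e1 e1 e1 + mu e1 e2 e2.
  have h := H e1 e2 e2; rewrite !sum3 !mxE /= in h.
  by apply: (mulfI nx); apply: (lincomb1 (c := 1) h); ring.
split=> //; split=> //.
- have h := H e1 e2 e1; rewrite !sum3 !mxE /= P2 in h.
  by apply: (lincomb1 (c := 1) h); ring.
- have h := H e1 f1 f1; rewrite !sum3 !mxE /= in h.
  by apply: (lincomb1 (c := 1) h); ring.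
- have h := H f1 e1 f1; rewrite !sum3 !mxE /= in h.
  by apply: (lincomb1 (c := 1) h); ring.
have h := H f1 f1 e2; rewrite !sum3 !mxE /= in h.
by apply: (lincomb1 (c := 1) h); ring.
Qed.

Lemma power_form mu : m11_variety mu -> mu e1 e1 e2 != 0 -> exists s1 s2 a b c,
  [/\ sorbit mu (fam 1 s1 s2 a b c), fam_type s1 s2 a b c & mu e1 f1 f1 = a] /\
  [/\ mu f1 e1 f1 = b, s1 + s2 = mu e1 e1 e1 + mu e1 e2 e2,
      - (s1 * s2) = mu e1 e2 e1 * mu e1 e1 e2 - mu e1 e2 e2 * mu e1 e1 e1 &
      c * mu e1 e1 e2 = mu f1 f1 e2].
Proof.
move=> Xmu nx; have [nu [[Rnu X1 X2] [P2 P1 A B W]]] := power_basis Xmu nx.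
have [s1 [s2 [a [b [c [E T]]]]]] := power_basis_form (m11_sorbit Rnu Xmu) X1 X2.
exists s1, s2, a, b, c; move: P2 P1 A B W; rewrite -E; split; split=> //.
- by rewrite -A E /fam /table /= mul1r.
- by rewrite -B E /fam /table /= mul1r.
- by rewrite -P2 E /fam /table /= mul1r.
- by rewrite -P1 E /fam /table /= mul1r.
- by rewrite -W E /fam /table /=.
Qed.

(* Invariantly: every even element is an eigenvector of squaring. *)
Definition squares_collinear mu := forall nu, sorbit mu nu -> nu e1 e1 e2 = 0.

Lemma squares_collinear_sorbit mu nu :
  sorbit mu nu -> squares_collinear mu -> squares_collinear nu.
Proof. by move=> h H rho /(sorbit_trans h) /H. Qed.

(** The equation expresses that [x = p e1 + r e2] and [xx] are linearly dependent. It follows by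
    completing [x] to a basis and taking the hypothesis in that basis. *)
Lemma squares_collinearP mu p r : squares_collinear mu -> (p != 0) || (r != 0) ->
  r * (p * p * mu e1 e1 e1 + p * r * mu e1 e2 e1 + r * p * mu e2 e1 e1 + r * r * mu e2 e2 e1) =
  p * (p * p * mu e1 e1 e2 + p * r * mu e1 e2 e2 + r * p * mu e2 e1 e2 + r * r * mu e2 e2 e2).
Proof.
move=> sq npr.
have [q [s nd]] : exists q s, p * s - q * r != 0.
  case/orP: npr => nz; [exists 0, 1 | exists 1, 0]; rewrite ?(mul0r, mulr1, subr0) //.
  by rewrite mulr0 mul1r sub0r oppr_eq0.
have [nu [/sq N H]] := change_basis mu (blockmx_in_group nd (oner_neq0 C)).
have {H} H i j k := intertwines_entry i j k H.
have h1 := H e1 e1 e1; have h2 := H e1 e1 e2; rewrite !sum3 !mxE /= N in h1 h2.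
by apply: (lincomb2 (c := - r) (d := p) h1 h2); ring.
Qed.

Lemma squares_collinear_form mu : m11_variety mu -> squares_collinear mu ->
  exists x d p1 p2 a1 a2 b1 b2 w1 w2,
  [/\ mu = table x 0 p1 p2 (d - p1) (x - p2) 0 d a1 a2 b1 b2 w1 w2, mu e1 e1 e1 = x & mu e2 e2 e2 = d].
Proof.
move=> /m11_varietyP [/even_table E _ _] sq.
have o : 1 != 0 :> C by rewrite oner_eq0.
have h1 : mu e1 e1 e2 = 0.
  by have /(_ 1 0) := squares_collinearP sq; rewrite o => /(_ isT) h; apply: (lincomb1 (c := -1) h); ring.
have h2 : mu e2 e2 e1 = 0.
  by have /(_ 0 1) := squares_collinearP sq; rewrite o orbT => /(_ isT) h; apply: (lincomb1 (c := 1) h); ring.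
(* The conditions at [e1 + e2] and [e1 - e2] polarize [xx = l(x) x] and determine
   [e1 e2 + e2 e1]. *)
have /(_ 1 1) := squares_collinearP sq; rewrite o => /(_ isT) h3.
have /(_ 1 (-1)) := squares_collinearP sq; rewrite o => /(_ isT) h4.
rewrite h1 h2 in h3 h4.
have h5 : mu e2 e1 e1 = mu e2 e2 e2 - mu e1 e2 e1.
  by apply: (lincomb2 (c := 2^-1) (d := 2^-1) h3 h4); field.
have h6 : mu e2 e1 e2 = mu e1 e1 e1 - mu e1 e2 e2.
  by apply: (lincomb2 (c := - 2^-1) (d := 2^-1) h3 h4); field.
do 10!eexists; split; [|reflexivity|reflexivity].
by rewrite {1}E h1 h2 h5 h6; reflexivity.
Qed.

(** When all even squares vanish, each remaining parameter other than those of [f1 f1] has square 0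
    by one coordinate of right alternativity. *)
Lemma squares_zero_form mu : m11_variety mu -> squares_collinear mu ->
  mu e1 e1 e1 = 0 -> mu e2 e2 e2 = 0 -> exists w1 w2, mu = table 0 0 0 0 0 0 0 0 0 0 0 0 w1 w2.
Proof.
move=> Xmu sq; have [x [d [p1 [p2 [a1 [a2 [b1 [b2 [w1 [w2 [E -> ->]]]]]]]]]]] := squares_collinear_form Xmu sq.
move=> x0 d0; move: Xmu; rewrite E x0 d0 => /m11_varietyP [_ ra _]; exists w1, w2.
have sq0 (u : C) : u * u = 0 -> u = 0 by move/eqP; rewrite mulf_eq0 orbb => /eqP.
have Ep2 : p2 = 0 by apply: sq0; have h := ra e2 e1 e1 e2; entry h; apply: (lincomb1 (c := 2^-1) h); field.
have Ep1 : p1 = 0 by apply: sq0; have h := ra e1 e2 e2 e1; entry h; apply: (lincomb1 (c := 2^-1) h); field.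
have Ea1 : a1 = 0 by apply: sq0; have h := ra e1 e1 f1 f1; entry h; apply: (lincomb1 (c := -1) h); ring.
have Ea2 : a2 = 0 by apply: sq0; have h := ra e2 e2 f1 f1; entry h; apply: (lincomb1 (c := -1) h); ring.
have Eb1 : b1 = 0 by apply: sq0; have h := ra f1 e1 e1 f1; entry h; apply: (lincomb1 (c := 2^-1) h); field.
have Eb2 : b2 = 0 by apply: sq0; have h := ra f1 e2 e2 f1; entry h; apply: (lincomb1 (c := 2^-1) h); field.
by rewrite Ep1 Ep2 Ea1 Ea2 Eb1 Eb2 subr0.
Qed.

(** Here [xx = l(x) x] with [l(e1) = x] and [l(e2) = d], not both zero. *)
Lemma squares_nonzero_form mu : m11_variety mu -> squares_collinear mu -> mu e1 e1 e1 != 0 ->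
  exists (l1 l2 : C) (a b : bool), l1 != 0 /\
    (mu = left_table l1 l2 a%:R b%:R \/ mu = right_table l1 l2 a%:R b%:R).
Proof.
move=> Xmu sq; have [x [d [p1 [p2 [a1 [a2 [b1 [b2 [w1 [w2 [E -> _]]]]]]]]]]] := squares_collinear_form Xmu sq.
move=> nx; move: Xmu; rewrite E => /m11_varietyP [_ ra mi].
(* A form [u] with [u(v)^2 = l(v) u(v)] is 0 or [l]. The two hypotheses are this equation at [e1]
   and its polarization at [e1], [e2]. *)
have chr u1 u2 : u1 * (u1 - x) = 0 -> d * u1 + x * u2 = 2 * u1 * u2 ->
    exists e : bool, u1 = e%:R * x /\ u2 = e%:R * d.
  move=> /eqP; rewrite mulf_eq0 subr_eq0 => /orP [] /eqP -> h.
    by exists false; split; rewrite mul0r //; apply: (mulfI nx); apply: (lincomb1 (c := 1) h); ring.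
  by exists true; split; rewrite mul1r //; apply: (mulfI nx); apply: (lincomb1 (c := -1) h); ring.
have [a [Ea1 Ea2]] : exists e : bool, a1 = e%:R * x /\ a2 = e%:R * d.
  apply: chr; first by have h := ra e1 e1 f1 f1; entry h; apply: (lincomb1 (c := -1) h); ring.
  have h := ra e1 e2 f1 f1; have h' := ra e2 e1 f1 f1; entry h; entry h'.
  by apply: (lincomb2 (c := 1) (d := 1) h h'); ring.
have [b [Eb1 Eb2]] : exists e : bool, b1 = e%:R * x /\ b2 = e%:R * d.
  apply: chr; first by have h := ra f1 e1 e1 f1; entry h; apply: (lincomb1 (c := 2^-1) h); field.
  by have h := ra f1 e1 e2 f1; entry h; apply: (lincomb1 (c := -1) h); ring.
have K1 : (x - p2) * (d - p1) = 0.
  by have h := ra e2 e1 e1 e1; entry h; apply: (lincomb1 (c := 2^-1) h); field.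
have K2 : p2 * (x - p2) = 0.
  by have h := ra e2 e1 e1 e2; entry h; apply: (lincomb1 (c := - 2^-1) h); field.
have K3 : p1 * p2 = 0.
  by have h := ra e1 e2 e2 e2; entry h; apply: (lincomb1 (c := 2^-1) h); field.
have nc (v : C) : v * x = 0 -> v = 0 by move/eqP; rewrite mulf_eq0 (negbTE nx) orbF => /eqP.
have n3 : 3 != 0 :> C by rewrite pnatr_eq0.
exists x, d, a, b; split=> //; rewrite {}Ea1 {}Ea2 {}Eb1 {}Eb2 in E ra mi *.
(* The case [p2 = 0] leads to [xy = l(y) x], and the case [p2 = x] to [xy = l(x) y]. *)
move: K2 => /eqP; rewrite mulf_eq0 subr_eq0 eq_sym => /orP [] /eqP Ep2.
  right; have Ep1 : p1 = d.
    by apply/eqP; rewrite eq_sym -subr_eq0; apply/eqP/nc; rewrite -K1 -Ep2; ring.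
  rewrite -Ep2 Ep1 in E ra mi *.
  (* It remains to kill [f1 f1], by cases on the two actions; the factor 3 that can appear is
     invertible in characteristic 0. *)
  suff [-> ->] : w1 = 0 /\ w2 = 0 by rewrite /right_table subrr subr0.
  have h1 := ra f1 e1 f1 e1; have h2 := ra f1 e1 f1 e2.
  have h3 := mi e1 f1 f1 e2; have h4 := mi e2 f1 f1 e2.
  entry h1; entry h2; entry h3; entry h4.
  case: a {E ra mi} h1 h2 h3 h4 => /= h1 h2 h3 h4; last first.
    by split; apply: nc; [apply: (lincomb1 (c := 1) h1) | apply: (lincomb1 (c := 1) h2)]; ring.
  have Ew2 : w2 = 0.
    case: b {h1 h2 h4} h3 => /= h3; apply: nc; first by apply: (lincomb1 (c := 1) h3); ring.
    by apply: (mulfI n3); apply: (lincomb1 (c := 1) h3); ring.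
  split=> //; rewrite Ew2 in h4; apply: nc; apply: (lincomb1 (c := -1) h4); ring.
left; have Ep1 : p1 = 0 by apply: nc; rewrite Ep2.
rewrite -Ep2 Ep1 in E ra mi *.
suff [-> ->] : w1 = 0 /\ w2 = 0 by rewrite /left_table subrr subr0.
have h1 := ra f1 e1 f1 e2; have h2 := ra f1 e2 f1 e2.
have h3 := mi e1 f1 f1 e1; have h4 := mi e1 f1 f1 e2; have h5 := ra f1 e1 f1 e1.
entry h1; entry h2; entry h3; entry h4; entry h5.
case: a {E ra mi} h1 h2 h3 h4 h5 => /= h1 h2 h3 h4 h5.
  have Ew2 : w2 = 0 by apply: nc; apply: (lincomb1 (c := -1) h1); ring.
  by split=> //; rewrite Ew2 in h2; apply: nc; apply: (lincomb1 (c := 1) h2); ring.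
case: b {h1 h2} h3 h4 h5 => /= h3 h4 h5.
  split; apply: nc; apply: (mulfI n3).
    by apply: (lincomb2 (c := -1) (d := 1) h3 h5); ring.
  by apply: (lincomb1 (c := -1) h4); ring.
split; apply: nc.
  by apply: (lincomb2 (c := -1) (d := 1) h3 h5); ring.
by apply: (lincomb1 (c := -1) h4); ring.
Qed.

End Classification.

(** * Degenerations *)

Section Closures.
Variable C : numClosedFieldType.
Implicit Types (mu nu : str C).

(** Uniform description of the five cases of [fam_type]: [a] and [b] are fixed linear combinations
    of [s1], [s2], and [ga] switches [f1 f1] on or off. *)
Definition generic_orbit (R : str C) (al1 al2 be1 be2 ga : C) := forall t s1 s2 c : C,
  t != 0 -> s1 != 0 -> s2 != 0 -> s1 - s2 != 0 -> c != 0 ->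
  sorbit R (fam t s1 s2 (al1 * s1 + al2 * s2) (be1 * s1 + be2 * s2) (ga * c)).

Lemma fam_zclosure R al1 al2 be1 be2 ga : generic_orbit R al1 al2 be1 be2 ga -> forall t s1 s2 c,
  zclosure (sorbit R) (fam t s1 s2 (al1 * s1 + al2 * s2) (be1 * s1 + be2 * s2) (ga * c)).
Proof.
move=> op t s1 s2 c.
(* Every parameter is perturbed to first order; the slope 2 in [S2] keeps [S1 - S2] from being the
   zero polynomial. *)
pose T := t%:P + 'X; pose S1 := s1%:P + 'X; pose S2 := s2%:P + 2%:R%:P * 'X; pose K := c%:P + 'X.
pose Nu := fam T S1 S2 (al1%:P * S1 + al2%:P * S2) (be1%:P * S1 + be2%:P * S2) (ga%:P * K).
pose q := T * S1 * S2 * (S1 - S2) * K.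
have EN x i j k : (Nu i j k).[x] = fam (t + x) (s1 + x) (s2 + 2 * x)
    (al1 * (s1 + x) + al2 * (s2 + 2 * x)) (be1 * (s1 + x) + be2 * (s2 + 2 * x)) (ga * (c + x)) i j k.
  rewrite -[LHS]/(horner_eval x _) fam_morph /= /horner_eval.
  by rewrite !(hornerD, hornerM, hornerC, hornerX).
have -> : fam t s1 s2 (al1 * s1 + al2 * s2) (be1 * s1 + be2 * s2) (ga * c) = fun i j k => (Nu i j k).[0].
  by apply: funext3 => i j k; rewrite EN !(mulr0, addr0).
have lin (u v : C) : v != 0 -> u%:P + v%:P * 'X != 0.
  move=> nv; apply/eqP => /(congr1 (coefp 1)) /eqP; rewrite /coefp coefD coefC coefCM coefX coef0 /=.
  by rewrite add0r mulr1 (negbTE nv).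
have lin1 (u : C) : u%:P + 'X != 0 by rewrite -[X in _ + X]mul1r -polyC1 lin ?oner_eq0.
have nS2 : S2 != 0 by rewrite lin ?pnatr_eq0.
have nS12 : S1 - S2 != 0.
  have -> : S1 - S2 = (s1 - s2)%:P + (- 1)%:P * 'X by rewrite /S1 /S2 polyCB polyCN polyC1 rmorph_nat; ring.
  by rewrite lin ?oppr_eq0 ?oner_eq0.
have nq : q != 0 by do ![apply: mulf_neq0 => //]; apply: lin1.
apply: (@zclosure_limit C _ Nu q 0 nq) => x; rewrite !(hornerM, hornerD, hornerN, hornerC, hornerX) !mulf_eq0 !negb_or.
move=> /andP [/andP [/andP [/andP [nt n1] n2] n12] nc].
have -> : (fun i j k => (Nu i j k).[x]) = fam (t + x) (s1 + x) (s2 + 2 * x)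
    (al1 * (s1 + x) + al2 * (s2 + 2 * x)) (be1 * (s1 + x) + be2 * (s2 + 2 * x)) (ga * (c + x)).
  by apply: funext3 => i j k; rewrite EN.
exact: op.
Qed.

(** Denominators are cleared so that [ring] can discharge the conditions for concrete parameters. *)
Lemma fam_generic_eq t s1 s2 a b c h x1 x2 y1 y2 w :
  t != 0 -> s1 != 0 -> s2 != 0 -> s1 - s2 != 0 -> h != 0 ->
  x1 * (s1 * (s1 - s2)) = a * (a - s2) -> x2 * (s2 * (s2 - s1)) = a * (a - s1) ->
  y1 * (s1 * (s1 - s2)) = b * (b - s2) -> y2 * (s2 * (s2 - s1)) = b * (b - s1) ->
  w = h ^+ 2 * c * t * s1 * (s1 - s2) ->
  @sorbit C (semisimple_table x1 x2 y1 y2 w) (fam t s1 s2 a b c).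
Proof.
move=> nt n1 n2 n12 nh.
have m1 : s1 * (s1 - s2) != 0 by rewrite mulf_neq0.
have m2 : s2 * (s2 - s1) != 0 by rewrite mulf_neq0 // -opprB oppr_eq0.
move=> /(canRL (mulfK m1)) -> /(canRL (mulfK m2)) -> /(canRL (mulfK m1)) -> /(canRL (mulfK m2)) -> ->.
exact: fam_generic.
Qed.

Lemma generic_orbit_R : [/\ generic_orbit (R01 C) 0 0 0 0 0, generic_orbit (R03 C) 1 0 1 0 1,
  generic_orbit (R04 C) 0 0 1 0 0, generic_orbit (R05 C) 1 0 0 0 0 & generic_orbit (R07 C) 0 1 1 0 0].
Proof.
have [[[-> -> -> -> ->] _] _] := RE C; split=> t s1 s2 c nt n1 n2 n12 nc;
  try by apply: (fam_generic_eq nt n1 n2 n12 (oner_neq0 C)); ring.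
(* Only [R03] has an odd square; rescaling [f1] by a square root of [1/v] makes it equal to [e1]. *)
pose v := c * t * s1 * (s1 - s2).
have nv : v != 0 by rewrite !mulf_neq0.
have nh : sqrtC v^-1 != 0 by rewrite sqrtC_eq0 invr_eq0.
apply: (fam_generic_eq nt n1 n2 n12 nh); try ring.
by rewrite mul1r sqrtCK -!mulrA !(mulrA c) !(mulrA _ s1) -/v mulVf.
Qed.

Lemma zclosure_fam_type t s1 s2 a b c : fam_type s1 s2 a b c ->
  exists k, zclosure (sorbit (Rk C k)) (fam t s1 s2 a b c).
Proof.
have [/fam_zclosure H1 /fam_zclosure H3 /fam_zclosure H4 /fam_zclosure H5 /fam_zclosure H7] := generic_orbit_R.
have E a' b' c' : a' = a -> b' = b -> c' = c -> fam t s1 s2 a' b' c' = fam t s1 s2 a b c by move=> -> -> ->.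
case=> [[-> -> ->]|[[-> ->]|[[-> -> ->]|[[-> -> ->]|[-> -> ->]]]]].
- exists (@Ordinal 13 0 isT); have := H1 t s1 s2 c; rewrite !mul0r addr0; exact.
- exists (@Ordinal 13 1 isT); have := H3 t s1 s2 c; rewrite !mul0r !mul1r !addr0; exact.
- exists (@Ordinal 13 2 isT); have := H4 t s1 s2 c; rewrite !mul0r !mul1r !addr0; exact.
- exists (@Ordinal 13 3 isT); have := H5 t s1 s2 c; rewrite !mul0r !mul1r !addr0; exact.
- exists (@Ordinal 13 4 isT); have := H7 t s1 s2 c; rewrite !mul0r !mul1r !addr0 !add0r; exact.
Qed.

Lemma zclosure_R03 t s1 s2 c : zclosure (sorbit (R03 C)) (fam t s1 s2 s1 s1 c).
Proof.
have [_ /fam_zclosure H3 _ _ _] := generic_orbit_R.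
by have := H3 t s1 s2 c; rewrite !mul0r !mul1r !addr0.
Qed.

(** Setting [t], [s1], [a], [b] to 0 in [fam] leaves only [f1 f1 = - c s2 e1 + c e2]. This reaches
    every vector with [w2 <> 0], and also multiples of [e2]; exchanging [e1] and [e2] gives
    multiples of [e1]. *)
Lemma zclosure_zero_table w1 w2 :
  zclosure (sorbit (R03 C)) (table 0 0 0 0 0 0 0 0 0 0 0 0 w1 w2).
Proof.
have E s2 c : table 0 0 0 0 0 0 0 0 0 0 0 0 (- (c * s2)) c = fam 0 0 s2 0 0 c :> str C.
  by rewrite /fam !mul0r oppr0.
case: (eqVneq w2 0) => [->|nw]; last first.
  have -> : w1 = - (w2 * (- w1 / w2)) by field.
  by rewrite E; apply: zclosure_R03.
have swap : @sorbit C (table 0 0 0 0 0 0 0 0 0 0 0 0 0 w1) (table 0 0 0 0 0 0 0 0 0 0 0 0 w1 0).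
  apply/sorbitE; exists (blockmx 0 1 1 0 1); split.
    by apply: blockmx_in_group; rewrite ?mul0r ?mul1r ?sub0r ?oppr_eq0 oner_eq0.
  apply: intertwines_basis; do 3![apply: ord3P]; rewrite !sum3 !mxE /table /=; ring.
apply: zclosure_orbit swap _.
have := E 0 w1; rewrite mulr0 oppr0 => ->; exact: zclosure_R03.
Qed.

Lemma Rk_left (a b : bool) : exists k, Rk C k = left_table 1 0 a%:R b%:R.
Proof.
have [[_ [E1 E2 E3 E4]] _] := RE C.
case: a b => [] [].
- by exists (@Ordinal 13 12 isT).
- by exists (@Ordinal 13 10 isT).
- by exists (@Ordinal 13 8 isT).
- by exists (@Ordinal 13 5 isT).
Qed.

Lemma Rk_right (a b : bool) : exists k, Rk C k = right_table 1 0 a%:R b%:R.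
Proof.
have [_ [E1 E2 E3 E4]] := RE C.
case: a b => [] [].
- by exists (@Ordinal 13 11 isT).
- by exists (@Ordinal 13 7 isT).
- by exists (@Ordinal 13 9 isT).
- by exists (@Ordinal 13 6 isT).
Qed.

Lemma squares_nonzero_Rk mu : m11_variety mu -> squares_collinear mu -> mu e1 e1 e1 != 0 ->
  exists k, sorbit (Rk C k) mu.
Proof.
move=> Xmu sq nx; have [l1 [l2 [a [b [n1 [->|->]]]]]] := squares_nonzero_form Xmu sq nx.
  by have [k E] := Rk_left a b; exists k; rewrite E; apply: left_iso.
by have [k E] := Rk_right a b; exists k; rewrite E; apply: right_iso.
Qed.

Lemma m11_cover mu : m11_variety mu -> exists k, zclosure (sorbit (Rk C k)) mu.
Proof.
move=> Xmu.
case: (classic (squares_collinear mu)) => [sq|/not_all_ex_not [nu nnu]]; last first.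
  have [Rnu /eqP nx] : sorbit mu nu /\ nu e1 e1 e2 <> 0 by apply: imply_to_and.
  have [s1 [s2 [a [b [c [[R' T _] _]]]]]] := power_form (m11_sorbit Rnu Xmu) nx.
  have [k ck] := zclosure_fam_type 1 T; exists k.
  exact: zclosure_orbit (sorbit_sym (sorbit_trans Rnu R')) ck.
case: (eqVneq (mu e1 e1 e1) 0) => [x0|nx]; last first.
  by have [k Rk] := squares_nonzero_Rk Xmu sq nx; exists k; apply: zclosure_sub.
case: (eqVneq (mu e2 e2 e2) 0) => [d0|nd].
  have [w1 [w2 ->]] := squares_zero_form Xmu sq x0 d0.
  by exists (@Ordinal 13 1 isT); apply: zclosure_zero_table.
(* Exchanging [e1] and [e2] reduces to the case where [l(e1)] is nonzero. *)
have GM : in_group (blockmx 0 1 1 0 1 : 'M[C]_3).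
  by apply: blockmx_in_group; rewrite ?mul0r ?mul1r ?sub0r ?oppr_eq0 oner_eq0.
have [nu [Rnu H]] := change_basis mu GM.
have h := intertwines_entry e1 e1 e2 H; rewrite !sum3 !mxE /= in h.
have nn : nu e1 e1 e1 != 0 by rewrite (_ : nu e1 e1 e1 = mu e2 e2 e2) //; apply: (lincomb1 (c := 1) h); ring.
have [k Rk] := squares_nonzero_Rk (m11_sorbit Rnu Xmu) (squares_collinear_sorbit Rnu sq) nn.
by exists k; apply: zclosure_sub; apply: sorbit_trans Rk (sorbit_sym Rnu).
Qed.

End Closures.

(** * Open orbits and isomorphism invariants *)

Section Rigidity.
Variable C : numClosedFieldType.
Implicit Types (mu nu : str C).

(* Left multiplication by e1 on the span of e1 and e1e1 has characteristic polynomial X^2 - lin1 X - lin0. *)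
Definition lin1 mu := mu e1 e1 e1 + mu e1 e2 e2.
Definition lin0 mu := mu e1 e2 e1 * mu e1 e1 e2 - mu e1 e2 e2 * mu e1 e1 e1.
Definition chpoly mu (x : C) := x ^+ 2 - lin1 mu * x - lin0 mu.
(** Nonzero exactly when [e1], [e1 e1] are independent and the roots 0, [s1], [s2] are distinct:
    [lin0 = - s1 s2] and [lin1^2 + 4 lin0 = (s1 - s2)^2]. *)
Definition separable_gen mu := mu e1 e1 e2 * lin0 mu * (lin1 mu ^+ 2 + 4 * lin0 mu).

Lemma separable_form mu : m11_variety mu -> separable_gen mu != 0 -> exists s1 s2 a b c,
  [/\ sorbit mu (fam 1 s1 s2 a b c), fam_type s1 s2 a b c, s1 != 0, s2 != 0 & s1 - s2 != 0] /\
  [/\ mu e1 f1 f1 = a, mu f1 e1 f1 = b, c * mu e1 e1 e2 = mu f1 f1 e2 &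
      forall x, chpoly mu x = (x - s1) * (x - s2)].
Proof.
move=> Xmu; rewrite !mulf_eq0 !negb_or => /andP [/andP [nx n0] nd].
have [s1 [s2 [a [b [c [[R' T A] [B E1 E0 W]]]]]]] := power_form Xmu nx.
exists s1, s2, a, b, c; rewrite /chpoly; move: n0 nd; rewrite /lin0 /lin1 -E0 -E1.
rewrite oppr_eq0 mulf_eq0 negb_or => /andP [n1 n2] nd; split; split=> //.
  by apply: contraNneq nd => h; apply/eqP; transitivity ((s1 - s2) ^+ 2); [ring | rewrite h expr0n].
by move=> x; ring.
Qed.

Ltac poly := rewrite /separable_gen /chpoly /lin0 /lin1;
  repeat first [apply: polynomialD | apply: polynomialN | apply: polynomialM | apply: polynomialX
               | apply: polynomial_coord | apply: polynomial_const].

(** Where [separable_gen] is nonzero the algebra has one of the five types of [fam_type]; the role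
    of [G] is to exclude the other four. *)
Lemma separable_open R (nu : str C) (G : str C -> C) :
  m11_variety R -> polynomial G -> sorbit R nu -> separable_gen nu * G nu != 0 ->
  (forall mu s1 s2 a b c, mu e1 f1 f1 = a -> mu f1 e1 f1 = b -> c * mu e1 e1 e2 = mu f1 f1 e2 ->
    s1 != 0 -> s2 != 0 -> s1 - s2 != 0 ->
    (forall x, chpoly mu x = (x - s1) * (x - s2)) -> G mu != 0 -> fam_type s1 s2 a b c ->
    sorbit R (fam 1 s1 s2 a b c)) ->
  rigid (@m11_variety C) R.
Proof.
move=> XR pG Rnu /eqP nF H.
apply: (orbit_open (F := fun mu => separable_gen mu * G mu) (@m11_sorbit C) XR _ Rnu nF).
  by apply: polynomialM pG; poly.
move=> mu Xmu /eqP; rewrite mulf_eq0 negb_or => /andP [ns nG].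
have [s1 [s2 [a [b [c [[R' T n1 n2 n12] [A B W E]]]]]]] := separable_form Xmu ns.
exact: sorbit_trans (H mu s1 s2 a b c A B W n1 n2 n12 E nG T) (sorbit_sym R').
Qed.

Lemma rigid_semisimple : [/\ rigid (@m11_variety C) (R01 C), rigid (@m11_variety C) (R03 C),
  rigid (@m11_variety C) (R04 C), rigid (@m11_variety C) (R05 C) & rigid (@m11_variety C) (R07 C)].
Proof.
have [g1 g3 g4 g5 g7] := generic_orbit_R C.
have o : 1 != 0 :> C by rewrite oner_eq0.
have o2 : 2 != 0 :> C by rewrite pnatr_eq0.
have o12 : 1 - 2 != 0 :> C by rewrite (_ : 1 - 2 = -1) ?oppr_eq0 //; ring.
have X k := m11_Rk C k.
have nat0 n (x : C) : x = - (n.+1)%:R -> x != 0 by move=> ->; rewrite oppr_eq0 pnatr_eq0.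
split.
(* In all five cases the sample point has [s1 = 1], [s2 = 2]. The successive [G] express: neither
   [a] nor [b] is a root [s1], [s2]; [c] is nonzero; only [b] is such a root; only [a] is; [a] and
   [b] are nonzero and different. *)
- apply: (separable_open (X (@Ordinal 13 0 isT)) _ (g1 1 1 2 1 o o o2 o12 o)
    (G := fun mu => chpoly mu (mu e1 f1 f1) * chpoly mu (mu f1 e1 f1))); first by poly.
    apply: (nat0 7%N); rewrite /separable_gen /chpoly /lin0 /lin1 /fam /table /=; ring.
  move=> mu s1 s2 a b c -> -> _ n1 n2 n12 E; rewrite !E => nG.
  case=> [[-> -> ->]|T]; first by have := g1 1 s1 s2 1 o n1 n2 n12 o; rewrite !mul0r addr0.
  case/eqP: nG.
  by case: T => [[-> ->]|[[-> -> _]|[[-> -> _]|[-> -> _]]]]; ring.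
- apply: (separable_open (X (@Ordinal 13 1 isT)) _ (g3 1 1 2 1 o o o2 o12 o)
    (G := fun mu => mu f1 f1 e2)); first by poly.
    apply: (nat0 1%N); rewrite /separable_gen /chpoly /lin0 /lin1 /fam /table /=; ring.
  move=> mu s1 s2 a b c _ _ <- n1 n2 n12 E; rewrite mulf_eq0 negb_or => /andP [nc _].
  case=> [[_ _ h]|[[-> ->]|[[_ _ h]|[[_ _ h]|[_ _ h]]]]]; try by rewrite h eqxx in nc.
  by have := g3 1 s1 s2 c o n1 n2 n12 nc; rewrite !mul0r !mul1r !addr0.
- apply: (separable_open (X (@Ordinal 13 2 isT)) _ (g4 1 1 2 1 o o o2 o12 o)
    (G := fun mu => chpoly mu (mu e1 f1 f1) * mu f1 e1 f1)); first by poly.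
    apply: (nat0 3%N); rewrite /separable_gen /chpoly /lin0 /lin1 /fam /table /=; ring.
  move=> mu s1 s2 a b c -> -> _ n1 n2 n12 E; rewrite !E => nG.
  case=> [T|[T|[[-> -> ->]|T]]]; last first.
  + by case/eqP: nG; case: T => [[-> -> _]|[-> -> _]]; ring.
  + by have := g4 1 s1 s2 1 o n1 n2 n12 o; rewrite !mul0r !mul1r !addr0.
  + by case/eqP: nG; case: T => -> ->; ring.
  + by case/eqP: nG; case: T => -> -> _; ring.
- apply: (separable_open (X (@Ordinal 13 3 isT)) _ (g5 1 1 2 1 o o o2 o12 o)
    (G := fun mu => mu e1 f1 f1 * chpoly mu (mu f1 e1 f1))); first by poly.
    apply: (nat0 3%N); rewrite /separable_gen /chpoly /lin0 /lin1 /fam /table /=; ring.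
  move=> mu s1 s2 a b c -> -> _ n1 n2 n12 E; rewrite !E => nG.
  case=> [T|[T|[T|[[-> -> ->]|T]]]]; last first.
  + by case/eqP: nG; case: T => -> -> _; ring.
  + by have := g5 1 s1 s2 1 o n1 n2 n12 o; rewrite !mul0r !mul1r !addr0.
  + by case/eqP: nG; case: T => -> -> _; ring.
  + by case/eqP: nG; case: T => -> ->; ring.
  + by case/eqP: nG; case: T => -> -> _; ring.
apply: (separable_open (X (@Ordinal 13 4 isT)) _ (g7 1 1 2 1 o o o2 o12 o)
    (G := fun mu => mu e1 f1 f1 * mu f1 e1 f1 * (mu e1 f1 f1 - mu f1 e1 f1))); first by poly.
  apply: (nat0 3%N); rewrite /separable_gen /chpoly /lin0 /lin1 /fam /table /=; ring.
move=> mu s1 s2 a b c -> -> _ n1 n2 n12 E nG.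
case=> [T|[T|[T|[T|[-> -> ->]]]]]; last first.
+ by have := g7 1 s1 s2 1 o n1 n2 n12 o; rewrite !mul0r !mul1r !addr0 !add0r.
+ by case/eqP: nG; case: T => -> -> _; ring.
+ by case/eqP: nG; case: T => -> -> _; ring.
+ by case/eqP: nG; case: T => -> ->; ring.
+ by case/eqP: nG; case: T => -> -> _; ring.
Qed.

(** Identities in three even arguments and one odd argument. When both sides are natural, they are
    isomorphism invariants, used to separate the thirteen algebras. *)
Definition ev_identity (L R : str C -> vec C -> vec C -> vec C -> vec C -> vec C) mu :=
  forall x y z u, homog false x -> homog false y -> homog false z -> homog true u ->
  L mu x y z u = R mu x y z u.

Definition natural (L : str C -> vec C -> vec C -> vec C -> vec C -> vec C) :=
  forall M mu nu x y z u, intertwines M mu nu ->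
  L nu (app M x) (app M y) (app M z) (app M u) = app M (L mu x y z u).

Lemma ev_identity_sorbit L R mu nu : natural L -> natural R -> sorbit mu nu ->
  ev_identity L R mu -> ev_identity L R nu.
Proof.
move=> nL nR /sorbitE [M [GM H]] I x y z u hx hy hz hu.
have GV := in_groupV GM; have uM := proj1 GM.
rewrite -(app_invK x uM) -(app_invK y uM) -(app_invK z uM) -(app_invK u uM).
by rewrite (nL _ _ _ _ _ _ _ H) (nR _ _ _ _ _ _ _ H) I //; apply: homog_app.
Qed.

Definition comm_even := ev_identity (fun mu x y _ _ => mulv mu x y) (fun mu x y _ _ => mulv mu y x).
Definition left_comm_even := ev_identity (fun mu x y z _ => mulv mu (mulv mu x y) z)
  (fun mu x y z _ => mulv mu (mulv mu y x) z).
Definition left_null := ev_identity (fun mu x _ _ u => mulv mu x u) (fun _ _ _ _ _ => fun=> 0).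
Definition right_null := ev_identity (fun mu x _ _ u => mulv mu u x) (fun _ _ _ _ _ => fun=> 0).
Definition comm_odd := ev_identity (fun mu x _ _ u => mulv mu x u) (fun mu x _ _ u => mulv mu u x).

Lemma natural0 : natural (fun _ _ _ _ _ => fun=> 0).
Proof.
move=> M mu nu x y z u H; apply: functional_extensionality => k.
by rewrite /app big1 // => i _; rewrite mulr0.
Qed.

Lemma identities_sorbit mu nu : sorbit mu nu ->
  [/\ comm_even mu -> comm_even nu, left_comm_even mu -> left_comm_even nu,
      left_null mu -> left_null nu, right_null mu -> right_null nu & comm_odd mu -> comm_odd nu].
Proof.
by move=> Rmu; split; apply: ev_identity_sorbit Rmu; try exact: natural0;
  move=> M mu' nu' x y z u H; rewrite !H.
Qed.

Lemma comm_even_fam t s1 s2 a b c : comm_even (fam t s1 s2 a b c).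
Proof.
move=> x y z u hx hy _ _; apply: functional_extensionality; apply: ord3P;
  rewrite /mulv !sum3 /fam /table /= (hx f1) // (hy f1) //; ring.
Qed.

(** An algebra with a basis [e1], [e1 e1] of its even part has a commutative even part. So an open
    condition, noncommutativity, implies the closed condition [squares_collinear]. *)
Lemma noncomm_squares_collinear mu :
  m11_variety mu -> mu e1 e2 e2 - mu e2 e1 e2 != 0 -> squares_collinear mu.
Proof.
move=> Xmu nc nu Rnu; apply: NNPP => /eqP nx.
have [s1 [s2 [a [b [c [[R' T _] _]]]]]] := power_form (m11_sorbit Rnu Xmu) nx.
have [/(_ (comm_even_fam 1 s1 s2 a b c)) cm _ _ _ _] :=
  identities_sorbit (sorbit_sym (sorbit_trans Rnu R')).
have := cm _ _ _ _ (@homog_bvec C e1) (@homog_bvec C e2) (@homog_bvec C e1) (@homog_bvec C f1).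
move=> /(congr1 (fun v => v e2)); rewrite !mulv_bvec => h.
by move: nc; rewrite h subrr eqxx.
Qed.

(** For [x] equal to 0 or [l], with [l] nonzero, it is nonzero exactly when [x = e l]: a polynomial
    test for which of the two values occurs. *)
Definition toggle (e : bool) (x l : C) := if e then x else x - l.

Lemma toggleP (e e' : bool) (l : C) : toggle e (e'%:R * l) l != 0 -> e' = e.
Proof. by case: e e' => [] []; rewrite /toggle /= ?mul0r ?mul1r ?subrr ?eqxx. Qed.

Lemma toggle_neq0 (e : bool) : toggle e (e%:R * 1) 1 != 0 :> C.
Proof. by case: e; rewrite /toggle /= ?mul0r ?mul1r ?sub0r ?oppr_eq0 oner_eq0. Qed.

Lemma polynomial_toggle e F G : polynomial F -> polynomial G ->
  polynomial (fun mu : str C => toggle e (F mu) (G mu)).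
Proof. by move=> pF pG; case: e => //; apply: polynomialB. Qed.

Lemma rigid_left (a b : bool) : rigid (@m11_variety C) (left_table 1 0 a%:R b%:R).
Proof.
have XR : m11_variety (left_table 1 0 a%:R b%:R : str C).
  by have [k <-] := Rk_left C a b; apply: m11_Rk.
(* The factor [mu e1 e2 e2] vanishes on every [right_table]; the toggles fix the two actions on
   [f1]. *)
apply: (orbit_open (F := fun mu => mu e1 e1 e1 * mu e1 e2 e2 * (mu e1 e2 e2 - mu e2 e1 e2) *
  toggle a (mu e1 f1 f1) (mu e1 e1 e1) * toggle b (mu f1 e1 f1) (mu e1 e1 e1))
  (@m11_sorbit C) XR _ (sorbit_refl _)).
- by poly; apply: polynomial_toggle; apply: polynomial_coord.
- by apply/eqP; rewrite /left_table /table /= subr0 !mul1r mulf_neq0 ?toggle_neq0.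
move=> mu Xmu /eqP; rewrite !mulf_eq0 !negb_or => /andP [/andP [/andP [/andP [nx np] nc] nA] nB].
have [l1 [l2 [a' [b' [n1 [E|E]]]]]] := squares_nonzero_form Xmu (noncomm_squares_collinear Xmu nc) nx.
  move: nA nB; rewrite E /left_table /table /= => /toggleP -> /toggleP ->; exact: left_iso.
by move: np; rewrite E /right_table /table /= eqxx.
Qed.

Lemma rigid_right (a b : bool) : rigid (@m11_variety C) (right_table 1 0 a%:R b%:R).
Proof.
have XR : m11_variety (right_table 1 0 a%:R b%:R : str C).
  by have [k <-] := Rk_right C a b; apply: m11_Rk.
apply: (orbit_open (F := fun mu => mu e1 e1 e1 * mu e2 e1 e2 * (mu e1 e2 e2 - mu e2 e1 e2) *
  toggle a (mu e1 f1 f1) (mu e1 e1 e1) * toggle b (mu f1 e1 f1) (mu e1 e1 e1))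
  (@m11_sorbit C) XR _ (sorbit_refl _)).
- by poly; apply: polynomial_toggle; apply: polynomial_coord.
- apply/eqP; rewrite /right_table /table /= sub0r !mul1r !mulf_neq0 ?toggle_neq0 //.
  by rewrite oppr_eq0 oner_eq0.
move=> mu Xmu /eqP; rewrite !mulf_eq0 !negb_or => /andP [/andP [/andP [/andP [nx np] nc] nA] nB].
have [l1 [l2 [a' [b' [n1 [E|E]]]]]] := squares_nonzero_form Xmu (noncomm_squares_collinear Xmu nc) nx.
  by move: np; rewrite E /left_table /table /= eqxx.
move: nA nB; rewrite E /right_table /table /= => /toggleP -> /toggleP ->; exact: right_iso.
Qed.

Lemma Rk_ind (P : nat -> str C -> Prop) :
  P 0%N (R01 C) -> P 1%N (R03 C) -> P 2%N (R04 C) -> P 3%N (R05 C) ->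
  P 4%N (R07 C) -> P 5%N (R23 C) -> P 6%N (R25 C) -> P 7%N (R26 C) ->
  P 8%N (R29 C) -> P 9%N (R31 C) -> P 10%N (R32 C) -> P 11%N (R33 C) ->
  P 12%N (R36 C) ->
  forall k : 'I_13, P k (Rk C k).
Proof.
move=> P01 P03 P04 P05 P07 P23 P25 P26 P29 P31 P32 P33 P36.
case=> [[|[|[|[|[|[|[|[|[|[|[|[|[|k]]]]]]]]]]]]] ltk];
  [exact: P01 | exact: P03 | exact: P04 | exact: P05 | exact: P07 | exact: P23
  | exact: P25 | exact: P26 | exact: P29 | exact: P31 | exact: P32 | exact: P33 | exact: P36 | discriminate ltk].
Qed.

Lemma rigid_Rk k : rigid (@m11_variety C) (Rk C k).
Proof.
have [h1 h3 h4 h5 h7] := rigid_semisimple.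
have [[_ [E23 E29 E32 E36]] [E25 E31 E26 E33]] := RE C.
move: k; apply: (Rk_ind (P := fun _ R => rigid (@m11_variety C) R)).
- exact: h1.
- exact: h3.
- exact: h4.
- exact: h5.
- exact: h7.
- rewrite E23; exact: (rigid_left false false).
- rewrite E25; exact: (rigid_right false false).
- rewrite E26; exact: (rigid_right true false).
- rewrite E29; exact: (rigid_left false true).
- rewrite E31; exact: (rigid_right false true).
- rewrite E32; exact: (rigid_left true false).
- rewrite E33; exact: (rigid_right true true).
- rewrite E36; exact: (rigid_left true true).
Qed.

Section TableIdentities.
Variables x1 x2 p1 p2 q1 q2 r1 r2 a1 a2 b1 b2 w1 w2 : C.
Let mu : str C := table x1 x2 p1 p2 q1 q2 r1 r2 a1 a2 b1 b2 w1 w2.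

Lemma comm_even_table : comm_even mu <-> (p1 == q1) && (p2 == q2).
Proof.
split=> [I|/andP [/eqP E1 /eqP E2] x y z u hx hy _ _]; last first.
  apply: functional_extensionality; apply: ord3P;
    rewrite /mulv !sum3 /mu /table /= (hx f1) // (hy f1) // ?E1 ?E2; ring.
have := I _ _ _ _ (@homog_bvec C e1) (@homog_bvec C e2) (@homog_bvec C e1) (@homog_bvec C f1).
move=> E; apply/andP; split; apply/eqP.
  by move: E => /(congr1 (fun v => v e1)); rewrite !mulv_bvec.
by move: E => /(congr1 (fun v => v e2)); rewrite !mulv_bvec.
Qed.

Lemma odd_identity_table (L R : str C -> vec C -> vec C -> vec C) (l1 l2 m1 m2 : C) :
  (forall x u, homog false x -> homog true u ->
     L mu x u = (fun k => if deg k then (x e1 * l1 + x e2 * l2) * u f1 else 0)) ->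
  (forall x u, homog false x -> homog true u ->
     R mu x u = (fun k => if deg k then (x e1 * m1 + x e2 * m2) * u f1 else 0)) ->
  ev_identity (fun mu x _ _ u => L mu x u) (fun mu x _ _ u => R mu x u) mu <->
  (l1 == m1) && (l2 == m2).
Proof.
move=> HL HR; split=> [I|/andP [/eqP E1 /eqP E2] x y z u hx _ _ hu]; last by rewrite HL // HR // E1 E2.
have h i : ~~ deg i -> L mu (bvec C i) (bvec C f1) f1 = R mu (bvec C i) (bvec C f1) f1.
  move=> di; have hi : homog false (bvec C i) by rewrite -(negbTE di); apply: homog_bvec.
  by rewrite (I _ _ _ _ hi hi hi (@homog_bvec C f1)).
have H i (hi : homog false (bvec C i)) := (HL _ _ hi (@homog_bvec C f1), HR _ _ hi (@homog_bvec C f1)).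
apply/andP; split; apply/eqP.
  by have := h e1 isT; rewrite !(H e1 (@homog_bvec C e1)) /= /bvec /= !(mul1r, mulr1, mul0r, addr0).
by have := h e2 isT; rewrite !(H e2 (@homog_bvec C e2)) /= /bvec /= !(mul1r, mulr1, mul0r, add0r).
Qed.

Lemma mulv_even_odd x u : homog false x -> homog true u ->
  mulv mu x u = (fun k => if deg k then (x e1 * a1 + x e2 * a2) * u f1 else 0).
Proof.
move=> hx hu; apply: functional_extensionality; apply: ord3P;
  rewrite /mulv !sum3 /mu /table /= (hx f1) // (hu e1) // (hu e2) //; ring.
Qed.

Lemma mulv_odd_even x u : homog false x -> homog true u ->
  mulv mu u x = (fun k => if deg k then (x e1 * b1 + x e2 * b2) * u f1 else 0).
Proof.
move=> hx hu; apply: functional_extensionality; apply: ord3P;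
  rewrite /mulv !sum3 /mu /table /= (hx f1) // (hu e1) // (hu e2) //; ring.
Qed.

Lemma zero_odd (x u : vec C) :
  (fun=> 0) = (fun k => if deg k then (x e1 * 0 + x e2 * 0) * u f1 else 0).
Proof. by apply: functional_extensionality => k; rewrite !mulr0 addr0 mul0r if_same. Qed.

Lemma left_null_table : left_null mu <-> (a1 == 0) && (a2 == 0).
Proof.
apply: (odd_identity_table (L := fun mu x u => mulv mu x u) (R := fun _ _ _ => fun=> 0)).
  exact: mulv_even_odd.
by move=> x u _ _; apply: zero_odd.
Qed.

Lemma right_null_table : right_null mu <-> (b1 == 0) && (b2 == 0).
Proof.
apply: (odd_identity_table (L := fun mu x u => mulv mu u x) (R := fun _ _ _ => fun=> 0)).
  exact: mulv_odd_even.
by move=> x u _ _; apply: zero_odd.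
Qed.

Lemma comm_odd_table : comm_odd mu <-> (a1 == b1) && (a2 == b2).
Proof.
apply: (odd_identity_table (L := fun mu x u => mulv mu x u) (R := fun mu x u => mulv mu u x)).
  exact: mulv_even_odd.
exact: mulv_odd_even.
Qed.

End TableIdentities.

Lemma left_comm_even_semisimple a1 a2 b1 b2 w : left_comm_even (semisimple_table a1 a2 b1 b2 w) <-> true.
Proof.
split=> // _ x y z u hx hy _ _; congr mulv.
have I : comm_even (semisimple_table a1 a2 b1 b2 w) by apply/comm_even_table; rewrite !eqxx.
exact: (I x y x (fun=> 0)).
Qed.

(** [(xy)z = l(x) l(y) z] is symmetric in [x] and [y], whereas [(xy)z = l(y) l(z) x] for the right
    tables is not. *)
Lemma left_comm_even_left l1 l2 a b : left_comm_even (left_table l1 l2 a b) <-> true.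
Proof.
split=> // _ x y z u hx hy hz _; apply: functional_extensionality; apply: ord3P;
  rewrite /mulv !sum3 /left_table /table /= (hx f1) // (hy f1) // (hz f1) //; ring.
Qed.

Lemma left_comm_even_right l2 a b : left_comm_even (right_table 1 l2 a b) <-> false.
Proof.
split=> // /(_ _ _ _ _ (@homog_bvec C e1) (@homog_bvec C e2) (@homog_bvec C e1) (@homog_bvec C f1)).
move=> /(congr1 (fun v => v e2)).
rewrite /mulv !sum3 /right_table /table /bvec /= !(mulr0, mulr1, mul0r, mul1r, addr0, add0r).
by move/esym/eqP; rewrite oner_eq0.
Qed.

(** Truth values of the five identities on each [Rk], in the order of [Rlist]; the thirteen rows are
    pairwise different. *)
Definition Rk_signature (k : nat) : bool * bool * bool * bool * bool := nth (true, true, true, true, true)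
  [:: (true, true, true, true, true); (true, true, false, false, true); (true, true, true, false, false);
      (true, true, false, true, false); (true, true, false, false, false);
      (false, true, true, true, true); (false, false, true, true, true); (false, false, false, true, false);
      (false, true, true, false, false); (false, false, true, false, false); (false, true, false, true, false);
      (false, false, false, false, true); (false, true, false, false, true)] k.

Lemma Rk_signatureP (k : 'I_13) : let: (s1, s2, s3, s4, s5) := Rk_signature k in
  [/\ comm_even (Rk C k) <-> s1, left_comm_even (Rk C k) <-> s2, left_null (Rk C k) <-> s3,
      right_null (Rk C k) <-> s4 & comm_odd (Rk C k) <-> s5].
Proof.
have [[[E01 E03 E04 E05 E07] [E23 E29 E32 E36]] [E25 E31 E26 E33]] := RE C.
have o := oner_eq0 C; have o' : (0 == 1 :> C) = false by rewrite eq_sym.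
move: k; apply: (Rk_ind (P := fun k R => let: (s1, s2, s3, s4, s5) := Rk_signature k in
  [/\ comm_even R <-> s1, left_comm_even R <-> s2, left_null R <-> s3,
      right_null R <-> s4 & comm_odd R <-> s5])); rewrite /Rk_signature /=;
  [rewrite E01 | rewrite E03 | rewrite E04 | rewrite E05 | rewrite E07 | rewrite E23 | rewrite E25
  | rewrite E26 | rewrite E29 | rewrite E31 | rewrite E32 | rewrite E33 | rewrite E36]; split;
  first [exact: left_comm_even_semisimple | exact: left_comm_even_left | exact: left_comm_even_right
        | apply: iff_trans (comm_even_table _ _ _ _ _ _ _ _ _ _ _ _ _ _) _
        | apply: iff_trans (left_null_table _ _ _ _ _ _ _ _ _ _ _ _ _ _) _
        | apply: iff_trans (right_null_table _ _ _ _ _ _ _ _ _ _ _ _ _ _) _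
        | apply: iff_trans (comm_odd_table _ _ _ _ _ _ _ _ _ _ _ _ _ _) _];
  by rewrite ?mulr1 ?mulr0 ?eqxx ?o ?o'.
Qed.

Lemma Rk_signature_inj (k l : 'I_13) : Rk_signature k = Rk_signature l -> k = l.
Proof.
case: k l => [k ltk] [l ltl] /= E; apply: val_inj => /=.
have un : uniq (map Rk_signature (iota 0 13)) by [].
apply/eqP; rewrite -(nth_uniq (Rk_signature 0) (s := map Rk_signature (iota 0 13))) ?size_map ?size_iota //.
by rewrite !(nth_map 0%N) ?size_iota // !nth_iota // !add0n E.
Qed.

Lemma sorbit_Rk_inj k l : sorbit (Rk C k) (Rk C l) -> k = l.
Proof.
move=> Rkl; apply: Rk_signature_inj.
have := Rk_signatureP k; have := Rk_signatureP l.
case: (Rk_signature k) => [[[[c1 c2] c3] c4] c5]; case: (Rk_signature l) => [[[[d1 d2] d3] d4] d5].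
move=> [y1 y2 y3 y4 y5] [x1 x2 x3 x4 x5].
have [u1 u2 u3 u4 u5] := identities_sorbit Rkl.
have [v1 v2 v3 v4 v5] := identities_sorbit (sorbit_sym Rkl).
have eqb (P Q : Prop) (c d : bool) : (P <-> c) -> (Q <-> d) -> (P -> Q) -> (Q -> P) -> c = d.
  by move=> h h' f g; apply/idP/idP => [/h /f /h'|/h' /g /h].
by rewrite (eqb _ _ _ _ x1 y1 u1 v1) (eqb _ _ _ _ x2 y2 u2 v2) (eqb _ _ _ _ x3 y3 u3 v3)
  (eqb _ _ _ _ x4 y4 u4 v4) (eqb _ _ _ _ x5 y5 u5 v5).
Qed.

End Rigidity.

(** * Krull dimension of orbit closures *)

Section LinearIndependence.
Variable C : numClosedFieldType.
Implicit Types (mu nu : str C) (X Y Z : sset C) (f p q : pexpr C).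

Definition lin_indep Y (I : finType) (g : I -> pexpr C) := forall c : I -> C,
  (forall mu, Y mu -> \sum_i c i * peval mu (g i) = 0) -> forall i, c i = 0.

Fixpoint ppow f n : pexpr C := if n is n'.+1 then PMul f (ppow f n') else PConst 1.

Lemma peval_ppow mu f n : peval mu (ppow f n) = peval mu f ^+ n.
Proof. by elim: n => //= n ->; rewrite exprS. Qed.

Lemma irreducible_prod Y F G : irreducible Y -> polynomial F -> polynomial G ->
  (forall mu, Y mu -> F mu * G mu = 0) ->
  (forall mu, Y mu -> F mu = 0) \/ (forall mu, Y mu -> G mu = 0).
Proof.
move=> [_ irr] pF pG FG.
have cF := @zclosed_zeros C unit (fun _ => F) (fun _ => pF).
have cG := @zclosed_zeros C unit (fun _ => G) (fun _ => pG).
case: (irr _ _ cF cG) => [mu Ymu|H|H].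
- have /eqP := FG _ Ymu; rewrite mulf_eq0 => /orP [/eqP E|/eqP E]; [by left | by right].
- by left=> mu /H /(_ tt).
- by right=> mu /H /(_ tt).
Qed.

Lemma polynomial_bigsum (I : finType) (F : I -> str C -> C) :
  (forall i, polynomial (F i)) -> polynomial (fun mu => \sum_i F i mu).
Proof.
move=> pF; have [p hp] := polynomial_sum (fun k : 'I_#|I| => pF (enum_val k)).
exists p => mu; rewrite hp [RHS](reindex (@enum_val I predT)) //=.
by exists enum_rank => i _; rewrite ?enum_valK ?enum_rankK.
Qed.

(** In a relation on [Y], the lowest power of [f] can be divided out since [Y] is irreducible and
    [f] is not zero on it. Restricting to [Y'], where [f = 0], leaves a relation among the [g i]. *)
Lemma lin_indep_step Y' Y (I : finType) (g : I -> pexpr C) f N :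
  irreducible Y -> subs Y' Y -> lin_indep Y' g ->
  (forall mu, Y' mu -> peval mu f = 0) -> (exists mu, Y mu /\ peval mu f <> 0) ->
  lin_indep Y (fun ij : I * 'I_N => PMul (g ij.1) (ppow f ij.2)).
Proof.
move=> irr YY' indg f0 [nu [Ynu nf]] c hc.
suff H n : forall i (j : 'I_N), (j < n)%N -> c (i, j) = 0 by case=> i j; apply: (H j.+1).
elim: n => [//|n IH] i j; rewrite ltnS leq_eqVlt => /orP [/eqP Ej|/IH //].
(* [Q] is the relation divided by [f^n]; the truncated exponents for [ij.2 < n] are harmless because
   those coefficients are already zero. *)
pose Q mu := \sum_ij c ij * (peval mu (g ij.1) * peval mu f ^+ (ij.2 - n)).
have pp p : polynomial (fun mu => peval mu p) by exists p.
have pQ : polynomial Q.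
  apply: polynomial_bigsum => ij; apply: polynomialM; first exact: polynomial_const.
  by apply: polynomialM; [| apply: polynomialX]; apply: pp.
have [h|Q0] : (forall mu, Y mu -> peval mu f ^+ n = 0) \/ (forall mu, Y mu -> Q mu = 0).
- apply: irreducible_prod => //; first by apply: polynomialX; apply: pp.
  move=> mu /hc <-; rewrite /Q big_distrr; apply: eq_bigr => -[i' j'] _ /=.
  rewrite peval_ppow; case: (ltnP j' n) => [/IH ->|lnj]; first by rewrite !mul0r mulr0.
  by rewrite -{2}(subnKC lnj) exprD; ring.
- by case: nf; apply/eqP; have /eqP := h _ Ynu; rewrite expf_eq0 => /andP [].
apply: (indg (fun i => c (i, j))) => mu Ymu.
transitivity (\sum_i' \sum_j' c (i', j') * (peval mu (g i') * peval mu f ^+ (j' - n))); last first.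
  by rewrite pair_bigA -[RHS](Q0 _ (YY' _ Ymu)); apply: eq_bigr => -[].
apply: eq_bigr => i' _; rewrite (bigD1 j) //= Ej subnn expr0 mulr1 big1 ?addr0 // => j' nj.
case: (ltngtP j' n) => [/IH ->|lt_nj|En]; first by rewrite mul0r.
  by rewrite f0 // expr0n subn_eq0 leqNgt lt_nj !mulr0.
by case/eqP: nj; apply: val_inj; rewrite /= En Ej.
Qed.

End LinearIndependence.

Section OrbitDimension.
Import mpoly.
Variable C : numClosedFieldType.
Variable R : str C.
Implicit Types (p q : pexpr C) (P Q : {mpoly C[5]}) (t : 'I_5 -> C).

Let pt (i : nat) (h : (i < 5)%N) : {mpoly C[5]} := 'X_(Ordinal h).
Definition generic_block : 'M[{mpoly C[5]}]_3 :=
  blockmx (@pt 0 isT) (@pt 1 isT) (@pt 2 isT) (@pt 3 isT) (@pt 4 isT).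
Definition generic_den : {mpoly C[5]} := \det generic_block ^+ 2.
Definition generic_act := actnum generic_block (fun i j k => (R i j k)%:MP).
Definition block_of t := map_mx (meval t) generic_block.

Lemma block_of_den t : (generic_den.@[t] != 0) = (block_of t \in unitmx).
Proof. by rewrite rmorphXn /= sqrf_eq0 unitmxE unitfE /block_of det_map_mx. Qed.

Lemma in_group_block_of M : in_group M -> exists t, block_of t = M.
Proof.
move=> [_ bM]; exists (fun i => nth 0 [:: M e1 e1; M e1 e2; M e2 e1; M e2 e2; M f1 f1] i).
apply/matrixP; do 2![apply: ord3P]; rewrite !mxE /pt /= ?mevalXU ?meval0 //; by rewrite bM.
Qed.

Lemma generic_actE t i j k : generic_den.@[t] != 0 ->
  generic_den.@[t] * act (block_of t) R i j k = (generic_act i j k).@[t].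
Proof.
rewrite block_of_den => ut; rewrite actnum_morph -/(block_of t).
rewrite (_ : (fun i j k => _) = R); last by apply: funext3 => *; rewrite /= mevalC.
by rewrite -act_actnum // rmorphXn /= /block_of det_map_mx.
Qed.

(** Pulled back to matrix entries, [p] is a fraction with denominator [generic_den ^+ d] and
    numerator of degree at most [K * d]; [msize] is the degree plus one. *)
Definition deg_bound (K d : nat) p := exists P, (msize P <= (K * d).+1)%N /\
  forall t, generic_den.@[t] != 0 -> P.@[t] = generic_den.@[t] ^+ d * peval (act (block_of t) R) p.

Lemma msizeM_bound P Q a b : (msize P <= a.+1)%N -> (msize Q <= b.+1)%N -> (msize (P * Q) <= (a + b).+1)%N.
Proof.
case: (eqVneq P 0) => [->|nP]; first by rewrite mul0r msize0.
case: (eqVneq Q 0) => [->|nQ]; first by rewrite mulr0 msize0.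
move=> hP hQ; rewrite msizeM //; have := leq_add hP hQ.
by rewrite addSn addnS; case: (_ + _)%N => // n; rewrite ltnS.
Qed.

Section Bound.
Variable K : nat.
Hypothesis K_den : (msize generic_den <= K.+1)%N.
Hypothesis K_act : forall i j k, (msize (generic_act i j k) <= K.+1)%N.

Lemma deg_boundM p q d e : deg_bound K d p -> deg_bound K e q -> deg_bound K (d + e) (PMul p q).
Proof.
move=> [P [sP hP]] [Q [sQ hQ]]; exists (P * Q); split; first by rewrite mulnDr; apply: msizeM_bound.
by move=> t nt; rewrite rmorphM /= hP // hQ // exprD; ring.
Qed.

Lemma msize_den e : (msize (generic_den ^+ e) <= (K * e).+1)%N.
Proof.
elim: e => [|e IH]; first by rewrite msize1.
by rewrite exprS mulnS; apply: msizeM_bound.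
Qed.

Lemma deg_bound_le p d e : (d <= e)%N -> deg_bound K d p -> deg_bound K e p.
Proof.
move=> le_de [P [sP hP]]; exists (generic_den ^+ (e - d) * P); split.
  by rewrite -{2}(subnK le_de) mulnDr; apply: msizeM_bound => //; apply: msize_den.
by move=> t nt; rewrite rmorphM rmorphXn /= hP // mulrA -exprD subnK.
Qed.

Lemma deg_bound_const c : deg_bound K 0 (PConst c).
Proof.
exists c%:MP; split; first by rewrite muln0 msizeC; case: eqP.
by move=> t _; rewrite mevalC mul1r.
Qed.

Lemma deg_bound_pow p d n : deg_bound K d p -> deg_bound K (n * d) (ppow p n).
Proof.
move=> hp; elim: n => [|n IH]; first exact: deg_bound_const.
by rewrite mulSn; apply: deg_boundM.
Qed.

Lemma deg_bound_ex p : exists d, deg_bound K d p.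
Proof.
elim: p => [c|i j k|p [d hp] q [e hq]|p [d hp] q [e hq]].
- by exists 0%N; apply: deg_bound_const.
- exists 1%N, (generic_act i j k); rewrite muln1; split=> // t nt.
  by rewrite expr1 generic_actE.
- have [P [sP hP]] := deg_bound_le (leq_addr e d) hp.
  have [Q [sQ hQ]] := deg_bound_le (leq_addl d e) hq.
  exists (d + e)%N, (P + Q); split.
    by apply: leq_trans (msizeD_le _ _) _; rewrite geq_max sP.
  by move=> t nt; rewrite rmorphD /= hP // hQ // mulrDr.
- by exists (d + e)%N; apply: deg_boundM.
Qed.

(** Only the [n ^ 5] monomials with all exponents below [n] can occur, so the coefficient matrix has
    more rows than columns and a nonzero left kernel. *)
Lemma mpoly_dependent (I : finType) (P : I -> {mpoly C[5]}) n :
  (forall i, (msize (P i) <= n)%N) -> (n ^ 5 < #|I|)%N ->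
  exists c : I -> C, (exists i, c i <> 0) /\ \sum_i c i *: P i = 0.
Proof.
move=> sP ltn.
pose T := {ffun 'I_5 -> 'I_n}.
pose mon (b : T) : 'X_{1..5} := [multinom (b i : nat) | i < 5].
pose A := \matrix_(a < #|I|, b < #|T|) (P (enum_val a))@_(mon (enum_val b)).
have nk : kermx A != 0.
  rewrite kermx_eq0 /row_free neq_ltn (leq_ltn_trans (rank_leq_col A)) //.
  by rewrite card_ffun !card_ord.
have [v vA nv] := rowV0Pn nk.
exists (fun i => v 0 (enum_rank i)); split.
  apply: NNPP => H; case/eqP: nv; apply/rowP => a; rewrite mxE.
  by apply: NNPP => na; apply: H; exists (enum_val a); rewrite enum_valK.
apply/mpolyP => m; rewrite mcoeff0 raddf_sum /=.
case: (altP (@forallP _ (fun i => (m i < n)%N))) => [lt_m|].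
  have /sub_kermxP /rowP /(_ (enum_rank [ffun i => Ordinal (lt_m i)])) := vA.
  rewrite !mxE => E; rewrite -[RHS]E [LHS](reindex (@enum_val I predT)) /=; last first.
    by exists enum_rank => i _; rewrite ?enum_valK ?enum_rankK.
  apply: eq_bigr => a _; rewrite mcoeffZ enum_valK mxE enum_rankK; congr (_ * mcoeff _ _).
  by apply/mnmP => i; rewrite mnmE ffunE.
rewrite negb_forall; case/existsP => i; rewrite -leqNgt => le_ni.
apply: big1 => a _; rewrite mcoeffZ memN_msupp_eq0 ?mulr0 //.
apply: msize_mdeg_ge; apply: leq_trans (sP a) _; apply: leq_trans le_ni _.
by rewrite mdegE (bigD1 i) //= leq_addr.
Qed.

Lemma orbit_no_chain6 : ~ has_chain (zclosure (sorbit R)) 6.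
Proof.
move=> [Ys [H1 H2]].
have step m : (m.+1 <= 6)%N -> exists f, (forall mu, Ys m mu -> peval mu f = 0) /\
    exists mu, Ys m.+1 mu /\ peval mu f <> 0.
  move=> lt_m; have [_ nsub] := H2 m lt_m.
  have [[Z [[S hS] hZ]] _] := H1 m (ltnW lt_m).
  have [[Z' [_ hZ']] _] := H1 m.+1 lt_m.
  apply: NNPP => nf; apply: nsub => mu Ymu; apply/hZ; split; first by have [] := (hZ' mu).1 Ymu.
  apply/hS => p Sp; apply: NNPP => np; apply: nf; exists p; split; last by exists mu.
  by move=> nu /hZ [_ /hS]; apply.
(* By induction, [Ys m] carries [N ^ m] independent products of powers of the [f], with denominator
   exponent linear in [N]. *)
have fam m : (m <= 6)%N -> exists d, forall N, exists (I : finType) (g : I -> pexpr C),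
    [/\ #|I| = (N ^ m)%N, lin_indep (Ys m) g & forall i, deg_bound K (N * d) (g i)].
  elim: m => [_|m IH lt_m].
    exists 0%N => N; exists 'I_1, (fun _ => PConst 1); split; first by rewrite card_ord.
      have [_ [[mu Ymu] _]] := H1 0%N isT.
      by move=> c /(_ mu Ymu); rewrite big_ord1 /= mulr1 => c0 i; rewrite ord1.
    by move=> i; rewrite muln0; apply: deg_bound_const.
  have [d hd] := IH (ltnW lt_m); have [f [f0 nf]] := step m lt_m.
  have [e he] := deg_bound_ex f; exists (d + e)%N => N.
  have [I [g [cI ig bg]]] := hd N.
  exists (I * 'I_N)%type, (fun ij : I * 'I_N => PMul (g ij.1) (ppow f ij.2)); split.
  - by rewrite card_prod card_ord cI expnSr.
  - have [_ irr] := H1 m.+1 lt_m; have [sub _] := H2 m lt_m.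
    exact: lin_indep_step ig f0 nf.
  - move=> [i j] /=; rewrite mulnDr; apply: deg_boundM => //.
    apply: deg_bound_le (deg_bound_pow j he); by rewrite leq_mul2r ltnW ?orbT.
have [d hd] := fam 6%N isT.
(* This is the least [N] with [((K * d).+1 * N) ^ 5 < N ^ 6]. *)
pose N := ((K * d).+1 ^ 5).+1; have [I [g [cI ig bg]]] := hd N.
have [P hP] := fin_all_exists bg.
have sP i : (msize (P i) <= (K * d).+1 * N)%N.
  by apply: leq_trans (hP i).1 _; rewrite mulSn mulnCA (mulnC N) -add1n leq_add2r.
have ltN : (((K * d).+1 * N) ^ 5 < #|I|)%N by rewrite cI expnMn [(N ^ 6)%N]expnS ltn_pmul2r ?expn_gt0.
have [c [[i nc] Ec]] := mpoly_dependent sP ltN.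
have orb0 : forall mu, sorbit R mu -> \sum_i c i * peval mu (g i) = 0.
  move=> mu [M [GM hM]]; have -> : mu = act M R by apply: funext3.
  have [t Et] := in_group_block_of GM.
  have nt : generic_den.@[t] != 0 by rewrite block_of_den Et; case: GM.
  apply: (mulfI (expf_neq0 (N * d) nt)); rewrite mulr0 big_distrr /=.
  have := congr1 (meval t) Ec; rewrite rmorph0 raddf_sum /= => {2}<-.
  by apply: eq_bigr => i' _; rewrite mevalZ (hP i').2 // Et mulrCA.
(* The relation holds on the orbit, hence on its closure, hence on [Ys 6], against independence. *)
apply: nc; apply: (ig c _ i) => mu Ymu.
have [[Z [_ hZ]] _] := H1 6%N isT; have [cmu _] := (hZ mu).1 Ymu.
have [q hq] : polynomial (fun mu => \sum_i c i * peval mu (g i)).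
  apply: polynomial_bigsum => j; apply: polynomialM; first exact: polynomial_const.
  by exists (g j).
by rewrite -hq; apply: cmu => nu Rnu; rewrite hq orb0.
Qed.

End Bound.

Lemma zclosure_orbit_no_chain6 : ~ has_chain (zclosure (sorbit R)) 6.
Proof.
pose s := msize generic_den :: [seq msize (generic_act i.1.1 i.1.2 i.2) | i : 'I_3 * 'I_3 * 'I_3].
have le_s x : x \in s -> (x <= (\max_(y <- s) y).+1)%N.
  by move=> xs; apply: leqW; rewrite (big_rem x) //= leq_maxl.
apply: (@orbit_no_chain6 (\max_(y <- s) y)); first by apply: le_s; rewrite inE eqxx.
move=> i j k; apply: le_s; rewrite inE; apply/orP; right.
by apply/mapP; exists (i, j, k); rewrite ?mem_enum.
Qed.

End OrbitDimension.

(** * Irreducible components *)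

Section Components.
Variable C : numClosedFieldType.
Implicit Types (mu nu : str C).

(** The first [m] of the parameters [t], [s1], [s2], [c] are free and the others are 0. The closures
    for [m] up to 4, followed by the orbit closure of [R03], form a chain of length 5. *)
Definition flag (m : nat) : sset C := fun mu => exists t s1 s2 c,
  [/\ (m < 1)%N -> t = 0, (m < 2)%N -> s1 = 0, (m < 3)%N -> s2 = 0, (m < 4)%N -> c = 0 &
      mu = fam t s1 s2 s1 s1 c].

Lemma flag_sub m : subs (flag m) (flag m.+1).
Proof.
move=> mu [t [s1 [s2 [c [ht h1 h2 hc E]]]]]; exists t, s1, s2, c.
by split=> // /ltnW.
Qed.

Lemma flag_rationally_connected m : rationally_connected (flag m).
Proof.
move=> u v [t [s1 [s2 [c [ht h1 h2 hc Eu]]]]] [t' [s1' [s2' [c' [ht' h1' h2' hc' Ev]]]]].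
pose L (a b : C) : {poly C} := a%:P + 'X * (b - a)%:P.
have EL a b x : (L a b).[x] = a + x * (b - a) by rewrite /L hornerD hornerM !hornerC hornerX.
have E x : curve 1 (fam (L t t') (L s1 s1') (L s2 s2') (L s1 s1') (L s1 s1') (L c c')) x =
    fam (t + x * (t' - t)) (s1 + x * (s1' - s1)) (s2 + x * (s2' - s2))
      (s1 + x * (s1' - s1)) (s1 + x * (s1' - s1)) (c + x * (c' - c)).
  apply: funext3 => i j k; rewrite /curve hornerC divr1 -[LHS]/(horner_eval x _) fam_morph /= /horner_eval.
  by rewrite !EL.
exists 1, (fam (L t t') (L s1 s1') (L s2 s2') (L s1 s1') (L s1 s1') (L c c')); split.
- by rewrite hornerC oner_eq0.
- by rewrite hornerC oner_eq0.
- move=> x _; do 4!eexists; split; last exact: E.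
  + by move=> h; rewrite ht // ht' // subrr mulr0 addr0.
  + by move=> h; rewrite h1 // h1' // subrr mulr0 addr0.
  + by move=> h; rewrite h2 // h2' // subrr mulr0 addr0.
  + by move=> h; rewrite hc // hc' // subrr mulr0 addr0.
- by rewrite E !mul0r !addr0 Eu.
- by rewrite E !mul1r ![_ + (_ - _)]addrC !subrK Ev.
Qed.

Lemma not_subs_zclosure (A B : sset C) F : polynomial F ->
  (forall mu, A mu -> F mu = 0) -> (exists mu, B mu /\ F mu <> 0) ->
  ~ subs (zclosure B) (zclosure A).
Proof.
move=> [p hp] F0 [mu [Bmu nF]] sub; apply: nF; rewrite -hp.
by apply: (sub mu (zclosure_sub Bmu)) => nu /F0; rewrite hp.
Qed.

Lemma R03_chain5 : has_chain (zclosure (sorbit (R03 C))) 5.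
Proof.
pose Y m := if (m < 5)%N then zclosure (flag m) else zclosure (sorbit (R03 C)).
have flagR m : subs (flag m) (zclosure (sorbit (R03 C))).
  by move=> _ [t [s1 [s2 [c [_ _ _ _ ->]]]]]; apply: zclosure_R03.
have YZ m : subs (Y m) (zclosure (sorbit (R03 C))).
  by rewrite /Y; case: ifP => _ // mu; apply: zclosure_mono; apply: flagR.
have o : 1 <> 0 :> C by apply/eqP; rewrite oner_eq0.
exists Y; split=> [m le_m|m lt_m].
  split.
    exists (Y m); split; last by move=> mu; split=> [h|[]//]; split=> //; apply: YZ h.
    by rewrite /Y; case: ifP => _; apply: zclosed_zclosure.
  rewrite /Y; case: ifP => _; last exact: irreducible_orbit_closure.
  apply: irreducible_zclosure (@flag_rationally_connected m).
  by exists (fam 0 0 0 0 0 0), 0, 0, 0, 0.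
split.
  rewrite /Y (lt_m : (m < 5)%N); case: ifP => _; apply: zclosure_mono; last exact: flagR.
  move=> mu /flag_sub; exact: zclosure_sub.
have pc := @polynomial_coord C.
(* The separating functions take on the family the values [t], [t s1], [t s2], [c]; the last one,
   [mu e1 e1 e1], is 0 on the family and 1 at [R03]. *)
case: m lt_m => [|[|[|[|[|m]]]]] // _; rewrite /Y /=.
- apply: (not_subs_zclosure (pc e1 e1 e2)).
    by move=> _ [t [s1 [s2 [c [-> // _ _ _ ->]]]]].
  by exists (fam 1 0 0 0 0 0); split=> //; exists 1, 0, 0, 0; split.
- apply: (not_subs_zclosure (pc e1 f1 f1)).
    by move=> _ [t [s1 [s2 [c [_ -> // _ _ ->]]]]]; rewrite /fam /table /= mulr0.
  exists (fam 1 1 0 1 1 0); split; last by rewrite /fam /table /= mulr1.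
  by exists 1, 1, 0, 0; split.
- apply: (not_subs_zclosure (polynomialB (pc e1 e2 e2) (pc e1 f1 f1))).
    by move=> _ [t [s1 [s2 [c [_ _ -> // _ ->]]]]]; rewrite /fam /table /= addr0 subrr.
  exists (fam 1 0 1 0 0 0); split; last by rewrite /fam /table /= mulr0 subr0 add0r mulr1.
  by exists 1, 0, 1, 0; split.
- apply: (not_subs_zclosure (pc f1 f1 e2)).
    by move=> _ [t [s1 [s2 [c [_ _ _ -> // ->]]]]].
  by exists (fam 0 0 0 0 0 1); split=> //; exists 0, 0, 0, 1; split.
apply: (not_subs_zclosure (pc e1 e1 e1)).
  by move=> _ [t [s1 [s2 [c [_ _ _ _ ->]]]]].
exists (R03 C); split; first exact: sorbit_refl.
by have [[[_ -> _ _ _] _] _] := RE C.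
Qed.

Let X := @m11_variety C.
Let O (k : 'I_13) := sorbit (Rk C k).

Lemma orbit_sub_m11 k : subs (O k) X.
Proof. by move=> mu /m11_sorbit; apply; apply: m11_Rk. Qed.

Lemma closure_sub_m11 k : subs (zclosure (O k)) X.
Proof. by apply: zclosure_min; [apply: zclosed_m11 | apply: orbit_sub_m11]. Qed.

Lemma rel_closed_closure k : rel_closed X (zclosure (O k)).
Proof.
exists (zclosure (O k)); split; first exact: zclosed_zclosure.
by move=> mu; split=> [h|[]//]; split=> //; apply: closure_sub_m11 h.
Qed.

(** If [A] missed the open orbit, it would lie in the closed complement, and so would its
    closure. *)
Lemma rigid_zclosure mu (A : sset C) : rigid X mu -> subs A X -> zclosure A mu -> X mu ->
  exists nu, A nu /\ sorbit mu nu.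
Proof.
move=> [Z [[S hS] hZ]] AX cmu Xmu; have [_ nZ] := (hZ mu).1 (sorbit_refl mu).
apply: NNPP => H; apply: nZ; apply: (zclosure_min (A := A)) cmu; first by exists S.
move=> nu Anu; apply: NNPP => nZnu; apply: H; exists nu; split=> //.
by apply/hZ; split=> //; apply: AX.
Qed.

Lemma Rk_in_closure k l : zclosure (O l) (Rk C k) -> k = l.
Proof.
move=> ckl; have [nu [Olnu Oknu]] := rigid_zclosure (rigid_Rk C k) (@orbit_sub_m11 l) ckl (m11_Rk C k).
exact/(@sorbit_Rk_inj C)/(sorbit_trans Oknu)/sorbit_sym.
Qed.

Lemma irreducible_in_closure Y : irreducible Y -> subs Y X -> exists k, subs Y (zclosure (O k)).
Proof.
move=> [[mu0 Ymu0] irr] YX.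
(* The closures are peeled off the finite union one at a time, each time by irreducibility. *)
pose U n mu := exists k : 'I_13, (k < n)%N /\ zclosure (O k) mu.
have cU n : zclosed (U n).
  elim: n => [|n [S hS]].
    (* The empty set is the zero set of the constant 1. *)
    by exists (fun p => p = PConst 1) => mu; split=> [[k []]//|/(_ _ erefl) /eqP]; rewrite /= oner_eq0.
  case: (ltnP n 13) => [ltn|le13].
    have [T hT] := zclosed_or (ex_intro _ S hS : zclosed (U n)) (zclosed_zclosure (O (Ordinal ltn))).
    exists T => mu; rewrite -hT; split=> [[k []]|[[k [ltk ck]]|ck]].
    - rewrite ltnS leq_eqVlt => /orP [/eqP Ek|ltk] ck; last by left; exists k.
      by right; have <- : k = Ordinal ltn by apply: val_inj.
    - by exists k; split=> //; apply: ltnW.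
    - by exists (Ordinal ltn).
  exists S => mu; rewrite -hS; split=> -[k [_ ck]]; exists k; split=> //.
    exact: leq_trans (ltn_ord k) le13.
  exact: leq_trans (ltn_ord k) (leqW le13).
have H n : (n <= 13)%N -> subs Y (U n) -> exists k, subs Y (zclosure (O k)).
  elim: n => [_ Y0|n IH ltn YU].
    by have [k []] := Y0 _ Ymu0.
  case: (irr _ _ (cU n) (zclosed_zclosure (O (Ordinal ltn)))).
  - move=> mu /YU [k []]; rewrite ltnS leq_eqVlt => /orP [/eqP Ek|ltk] ck; last by left; exists k.
    by right; have <- : k = Ordinal ltn by apply: val_inj.
  - exact: IH (ltnW ltn).
  - by exists (Ordinal ltn).
by apply: (H 13%N) => // mu /YX /m11_cover [k ck]; exists k.
Qed.

Lemma irr_component_m11 Y : irr_component X Y <-> exists k : 'I_13, seqs Y (zclosure (O k)).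
Proof.
have main k : irr_component X (zclosure (O k)).
  split; first exact: rel_closed_closure.
  split; first exact: irreducible_orbit_closure.
  move=> Y' [Z [_ hZ]] irrY' sub.
  have [l subl] := irreducible_in_closure irrY' (fun mu h => ((hZ mu).1 h).1).
  (* [Y'] contains [Rk k] and lies in the closure of orbit [l]; since the orbit of [Rk k] is open,
     this forces [k = l]. *)
  have E : k = l by apply/Rk_in_closure/subl/sub/zclosure_sub/sorbit_refl.
  by rewrite E.
split=> [[[Z [cZ hZ]] [irrY maxY]]|[k E]].
  have [k sub] := irreducible_in_closure irrY (fun mu h => ((hZ mu).1 h).1).
  have sub' := maxY _ (rel_closed_closure k) (irreducible_orbit_closure (Rk C k)) sub.
  by exists k => mu; split=> [/sub|/sub'].
rewrite (_ : Y = zclosure (O k)) //.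
by apply: functional_extensionality => mu; apply: propositional_extensionality.
Qed.

Lemma variety_dim_m11 : variety_dim X 5.
Proof.
split.
  exists (zclosure (sorbit (R03 C))); split; last exact: R03_chain5.
  by apply/irr_component_m11; exists (@Ordinal 13 1 isT).
move=> Z /irr_component_m11 [k E]; rewrite (_ : Z = zclosure (O k)); first exact: zclosure_orbit_no_chain6.
by apply: functional_extensionality => mu; apply: propositional_extensionality.
Qed.

Lemma closures_distinct k l : seqs (zclosure (O k)) (zclosure (O l)) -> k = l.
Proof. by move=> E; apply/Rk_in_closure/E/zclosure_sub/sorbit_refl. Qed.

(** A rigid [mu] lies in some closure, so its open orbit meets, and therefore equals, the orbit of
    that [Rk]. *)
Lemma rigid_m11 mu : X mu -> (rigid X mu <-> exists k : 'I_13, O k mu).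
Proof.
move=> Xmu; split=> [rmu|[k Okmu]].
  have [k ck] := m11_cover Xmu; exists k.
  have [nu [Oknu munu]] := rigid_zclosure rmu (@orbit_sub_m11 k) ck Xmu.
  exact: sorbit_trans Oknu (sorbit_sym munu).
have [Z [cZ hZ]] := rigid_Rk C k; exists Z; split=> // nu; rewrite -hZ.
by split; apply: sorbit_trans => //; apply: sorbit_sym.
Qed.

End Components.

Theorem mainTheorem14 :
  (* the variety has dimension 5 *)
  variety_dim (@m11_variety CC) 5 /\
  (* its irreducible components are exactly the closures of the orbits of R_k *)
  (forall Y : sset CC, irr_component (@m11_variety CC) Y <->
     exists k : 'I_13, seqs Y (zclosure (sorbit (Rk CC k)))) /\
  (* these 13 components are pairwise distinct *)
  (forall k l : 'I_13, seqs (zclosure (sorbit (Rk CC k))) (zclosure (sorbit (Rk CC l))) -> k = l) /\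
  (* the rigid superalgebras are exactly those isomorphic to some R_k *)
  (forall mu : str CC, m11_variety mu -> (rigid (@m11_variety CC) mu <-> exists k : 'I_13, sorbit (Rk CC k) mu)).
Proof.
(* [CC] is declared only as a field; naming [complex Rdefinitions.R] recovers its structure of
   algebraically closed numeric field. *)
split; first exact: (@variety_dim_m11 (complex Rdefinitions.R)).
split; first exact: (@irr_component_m11 (complex Rdefinitions.R)).
split; first exact: (@closures_distinct (complex Rdefinitions.R)).
exact: (@rigid_m11 (complex Rdefinitions.R)).
Qed.
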